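(* Let $A=\varprojlim_{n} A_n$ be a locally compact $\sigma$-$C^*$-algebra, and let $\pi_n:A\to A_n$, the sequence $(e_n)$ and the support algebra $A_{00}=\bigcup_n Ae_n^2A$ be as in the definition of local compactness. Let $A_0$ be the $C^*$-subalgebra of $A_b$ which is the norm closure of $A_{00}$ in $A_b$. Then $A_{00}=K(A_0)$, and $A\cong\Gamma(K(A_0))$ as $\sigma$-$C^*$-algebras, and $A_b\cong M(A_0)$ as $C^*$-algebras. Moreover, the $C^*$-algebra $A_0$ is unique (up to isomorphism) if the isomorphism from $A$ onto $\Gamma(K(A_0))$ is required to be bicontinuous for the $A_{00}$-topology on $A$ and the $\kappa$-topology on $\Gamma(K(A_0))$: if $C_0$ and $D_0$ are $C^*$-algebras for which there are $*$-isomorphisms $A\to\Gamma(K(C_0))$ and $A\to\Gamma(K(D_0))$ that are homeomorphisms from $A$ with the $A_{00}$-topology onto $\Gamma(K(C_0))$, respectively $\Gamma(K(D_0))$, with the $\kappa$-topology, then $C_0\cong D_0$.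
   Context: For subsets of an algebra, a product such as $AxA$ denotes the linear span of the products. A $\sigma$-$C^*$-algebra is a topological $*$-algebra that is the inverse limit $A=\varprojlim_n A_n$ of a sequence of $C^*$-algebras (connecting maps are $*$-homomorphisms); $\pi_n:A\to A_n$ are the canonical maps, $\|\cdot\|_n$ is the norm of $A_n$, and the projective topology of $A$ is given by the seminorms $a\mapsto\|\pi_n(a)\|_n$. Isomorphism as $\sigma$-$C^*$-algebras means $*$-isomorphism that is a homeomorphism. Put $\|a\|_\infty=\sup_n\|\pi_n(a)\|_n$ and let $A_b=\{a\in A:\|a\|_\infty<\infty\}$, a $C^*$-algebra. An element $x\in A^+$ is multiplicatively bounded if $Ax\subseteq A_b$. For a sequence $(e_n)$ of multiplicatively bounded elements of $A^+$, the corresponding support algebra is the two-sided ideal $A_{00}=\bigcup_n Ae_n^2A$ (contained in $A_b$). The $A_{00}$-topology on $A$ is the weakest topology making the maps $A\to A_b$, $a\mapsto xa$ and $a\mapsto ax$, continuous for all $x\in A_{00}$, where $A_b$ has its norm topology. $(e_n)$ is canonical if $e_me_n=e_n$ for all $n<m$. A unital $\sigma$-$C^*$-algebra $A$ is locally compact if it has a presentation $A=\varprojlim_n A_n$ with all $\pi_n:A\to A_n$ surjective and a multiplicatively bounded canonical sequence $(e_n)$ with $0\le e_n\le1$ such that, with $A_{00}=\bigcup_nAe_n^2A$: $e_n\to1$ in the $A_{00}$-topology, $A$ is complete in the $A_{00}$-topology, and for all $n$ and all $a\in A$, $$\sup\{\|e_nba\|_\infty: b\in A,\ \|e_nb\|_\infty\le1\}\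 \ge\ \|\pi_n(a)\|_n\ \ge\ \|e_na\|_\infty .$$ For a $C^*$-algebra $A_0$, $K(A_0)$ is its Pedersen ideal, the minimum dense two-sided ideal (explicitly, the linear span of all $x\in A_0^+$ with $x\le\sum_{k=1}^n x_k$ for some $x_k\in A_0^+$ such that $x_ky_k=x_k$ for some $y_k\in A_0^+$). $M(A_0)$ is the multiplier algebra. For an algebra $J$, $\Gamma(J)$ is the algebra of (double) multipliers: pairs $(S,T)$ of maps $J\to J$ with $xS(y)=T(x)y$ for all $x,y\in J$, product $(S,T)(U,V)=(SU,VT)$ and, if $J$ is a $*$-algebra, involution $(S,T)^*=(T^*,S^* )$ where $S^*(x)=S(x^* )^*$. $\Gamma(K(A_0))$ carries the projective topology given by the seminorms $(S,T)\mapsto\|S|_{L_a}\|$, $a\in K(A_0)^+$, where $L_a=\overline{A_0a}\subseteq K(A_0)$; when $A_0$ is $\sigma$-unital this makes it a $\sigma$-$C^*$-algebra. The $\kappa$-topology on $\Gamma(K(A_0))$ is given by the seminorms $(S,T)\mapsto\|S(a)\|$ and $(S,T)\mapsto\|T(a)\|$, $a\in K(A_0)$. *)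

(* Defs.v *)
From HB Require Import structures.
From mathcomp Require Import all_boot all_order all_algebra.
From mathcomp Require Import all_classical all_reals all_analysis.
From mathcomp Require Import complex.

Set Implicit Arguments.
Unset Strict Implicit.
Unset Printing Implicit Defensive.

Import Order.TTheory GRing.Theory Num.Theory.
Import numFieldNormedType.Exports.

Local Open Scope classical_set_scope.
Local Open Scope ring_scope.

Reserved Notation "x ** y" (at level 40, left associativity).

(* Multiplication is not that of a pzRingType because the algebras need not have
   a unit. *)
HB.mixin Record hasStarOps (R : realType) A & GRing.Lmodule R[i] A := {
  smul : A -> A -> A;
  star : A -> A }.

#[short(type="starOpsType")]
HB.structure Definition StarOps (R : realType) :=
  {A of GRing.Lmodule R[i] A & hasStarOps R A}.

Notation "x ** y" := (smul x y) : ring_scope.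

HB.mixin Record isStarAlgebra (R : realType) A & StarOps R A := {
  smulA : forall x y z : A, x ** (y ** z) = x ** y ** z;
  smulDl : forall x y z : A, (x + y) ** z = x ** z + y ** z;
  smulDr : forall x y z : A, x ** (y + z) = x ** y + x ** z;
  smulZl : forall (c : R[i]) (x y : A), (c *: x) ** y = c *: (x ** y);
  smulZr : forall (c : R[i]) (x y : A), x ** (c *: y) = c *: (x ** y);
  starK : forall x : A, star (star x) = x;
  starD : forall x y : A, star (x + y) = star x + star y;
  starZ : forall (c : R[i]) (x : A), star (c *: x) = c^* *: star x;
  starM : forall x y : A, star (x ** y) = star y ** star x }.

#[short(type="starAlgType")]
HB.structure Definition StarAlgebra (R : realType) :=
  {A of StarOps R A & isStarAlgebra R A}.

HB.mixin Record isPreCStar (R : realType) A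
    & StarAlgebra R A & NormedModule R[i] A := {
  norm_smul : forall x y : A, `|x ** y| <= `|x| * `|y|;
  norm_star_smul : forall x : A, `|star x ** x| = `|x| ^+ 2 }.

#[short(type="preCstarType")]
HB.structure Definition PreCStar (R : realType) :=
  {A of StarAlgebra R A & NormedModule R[i] A & isPreCStar R A}.

#[short(type="cstarType")]
HB.structure Definition CStar (R : realType) :=
  {A of PreCStar R A & CompleteNormedModule R[i] A}.

(* The norm of a normedModType R[i] takes its values in R[i]; rnorm is the same
   norm with values in R. *)
Section RealNorm.
Variables (R : realType) (V : normedModType R[i]).

Definition rnorm (x : V) : R := complex.Re `|x|.

Lemma rnormE (x : V) : `|x| = ((rnorm x)%:C)%C.
Proof.
have := normr_ge0 x; rewrite /rnorm; case: (`|x|) => a b /=.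
by rewrite lecE /= => /andP[/eqP -> _].
Qed.

Lemma rnorm_ge0 (x : V) : 0 <= rnorm x.
Proof. by have := normr_ge0 x; rewrite rnormE lecR. Qed.

Lemma rnorm0 : rnorm 0 = 0.
Proof. by rewrite /rnorm normr0. Qed.

Lemma rnormD (x y : V) : rnorm (x + y) <= rnorm x + rnorm y.
Proof. by rewrite -lecR rmorphD /= -!rnormE ler_normD. Qed.

Lemma rnorm_eq0 (x : V) : rnorm x = 0 -> x = 0.
Proof. by move=> h; apply/eqP; rewrite -normr_eq0 rnormE h. Qed.

End RealNorm.

Lemma rnormZ (R : realType) (V : normedModType R[i]) (c : R[i]) (x : V) :
  rnorm (c *: x) = Normc.normc c * rnorm x.
Proof. by apply: complexI; rewrite rmorphM /= -!rnormE normrZ. Qed.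

Section StarAlgTheory.
Variables (R : realType) (A : starAlgType R).
Implicit Types x y z : A.

Lemma smul0l y : 0 ** y = 0 :> A.
Proof. by have := smulZl 0 (0 : A) y; rewrite !scale0r. Qed.

Lemma smul0r x : x ** 0 = 0 :> A.
Proof. by have := smulZr 0 x (0 : A); rewrite !scale0r. Qed.

Lemma smulNl x y : (- x) ** y = - (x ** y).
Proof. by rewrite -scaleN1r smulZl scaleN1r. Qed.

Lemma smulNr x y : x ** (- y) = - (x ** y).
Proof. by rewrite -scaleN1r smulZr scaleN1r. Qed.

Lemma smulBl x y z : (x - y) ** z = x ** z - y ** z.
Proof. by rewrite smulDl smulNl. Qed.

Lemma smulBr x y z : x ** (y - z) = x ** y - x ** z.
Proof. by rewrite smulDr smulNr. Qed.

Lemma star0 : star 0 = 0 :> A.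
Proof. by have := starZ 0 (0 : A); rewrite rmorph0 !scale0r. Qed.

Lemma starN x : star (- x) = - star x.
Proof. by rewrite -scaleN1r starZ rmorphN1 scaleN1r. Qed.

Lemma starB x y : star (x - y) = star x - star y.
Proof. by rewrite starD starN. Qed.

(* In a C*-algebra or a sigma-C*-algebra the positive elements are those of the
   form y^* y. *)
Definition positive : set A := [set x | exists y, x = star y ** y].

Definition lspan (S : set A) : set A :=
  [set x | exists (n : nat) (c : 'I_n -> R[i]) (v : 'I_n -> A),
     (forall k, S (v k)) /\ x = \sum_(k < n) c k *: v k].

Definition two_sided_ideal (J : set A) : Prop :=
  [/\ J 0,
      forall x y, J x -> J y -> J (x + y),
      forall (c : R[i]) x, J x -> J (c *: x) &
      forall x b, J x -> J (b ** x) /\ J (x ** b)].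

Lemma positive_star x : positive x -> star x = x.
Proof. by case=> y ->; rewrite starM starK. Qed.

Lemma lspan_ind (S P : set A) : P 0 ->
  (forall x y, P x -> P y -> P (x + y)) ->
  (forall (c : R[i]) x, P x -> P (c *: x)) ->
  S `<=` P -> lspan S `<=` P.
Proof.
move=> P0 PD PZ SP _ [n [c [v [Sv ->]]]].
by apply: big_ind => // k _; exact/PZ/SP/Sv.
Qed.

Lemma lspan0 (S : set A) : lspan S 0.
Proof. by exists 0, (fun=> 0), (fun=> 0); split; [case|rewrite big_ord0]. Qed.

Lemma lspanD (S : set A) x y : lspan S x -> lspan S y -> lspan S (x + y).
Proof.
move=> [n [c [v [Sv ->]]]] [m [d [w [Sw ->]]]].
exists (n + m)%N, (fun k => match fintype.split k with inl i => c i | inr i => d i end),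
  (fun k => match fintype.split k with inl i => v i | inr i => w i end).
split; first by move=> k; case: (fintype.split k).
rewrite big_split_ord /=; congr (_ + _); apply: eq_bigr => k _.
  by rewrite (unsplitK (inl k)).
by rewrite (unsplitK (inr k)).
Qed.

Lemma lspanZ (S : set A) (c : R[i]) x : lspan S x -> lspan S (c *: x).
Proof.
move=> [n [d [v [Sv ->]]]]; exists n, (fun k => c * d k), v; split=> //.
by rewrite scaler_sumr; apply: eq_bigr => k _; rewrite scalerA.
Qed.

Lemma lspan_sub (S : set A) : S `<=` lspan S.
Proof.
move=> x Sx; exists 1, (fun=> 1), (fun=> x); split=> //.
by rewrite big_ord1 scale1r.
Qed.

End StarAlgTheory.

Section Morphisms.
Variable R : realType.

Definition star_hom (A B : starOpsType R) (f : A -> B) : Prop :=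
  [/\ linear f,
      forall x y, f (x ** y) = f x ** f y &
      forall x, f (star x) = star (f x)].

Definition star_iso (A B : starOpsType R) (f : A -> B) : Prop :=
  star_hom f /\ bijective f.

Definition homeomorphism (X Y : topologicalType) (f : X -> Y) : Prop :=
  continuous f /\ exists g : Y -> X, [/\ cancel f g, cancel g f & continuous g].

Definition cstar_isomorphic (B D : preCstarType R) : Prop :=
  exists2 f : B -> D, star_iso f & forall x, `|f x| = `|x|.

End Morphisms.

Record starSubalg (R : realType) (A : starAlgType R) := StarSubalg {
  subalg_set :> set A;
  subalg0 : subalg_set 0;
  subalgD : forall x y, subalg_set x -> subalg_set y -> subalg_set (x + y);
  subalgZ : forall (c : R[i]) x, subalg_set x -> subalg_set (c *: x);
  subalgM : forall x y, subalg_set x -> subalg_set y -> subalg_set (x ** y);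
  subalgS : forall x, subalg_set x -> subalg_set (star x) }.

Section SubalgType.
Variables (R : realType) (A : starAlgType R) (S : starSubalg A).

Definition subalg_pred : {pred A} := fun x => `[< (S : set A) x >].

Record subalg_type := SubalgType {
  subalg_val : A;
  subalg_valP : subalg_val \in subalg_pred }.

HB.instance Definition _ := [isSub for subalg_val].
HB.instance Definition _ := [Choice of subalg_type by <:].

Definition subalg_in (x : A) (Sx : (S : set A) x) : subalg_type :=
  SubalgType (asboolT Sx : x \in subalg_pred).

Lemma subalg_valS (x : subalg_type) : (S : set A) (subalg_val x).
Proof. exact: asboolW (subalg_valP x). Qed.

Lemma subalg_inj : injective subalg_val.
Proof. exact: val_inj. Qed.

Local Notation ty := subalg_type.

Lemma subalg_opp_subproof (x : ty) : (S : set A) (- subalg_val x).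
Proof. by rewrite -scaleN1r; exact/subalgZ/subalg_valS. Qed.

Definition subalg_zero : ty := subalg_in (subalg0 S).
Definition subalg_add (x y : ty) : ty :=
  subalg_in (subalgD (subalg_valS x) (subalg_valS y)).
Definition subalg_opp (x : ty) : ty := subalg_in (subalg_opp_subproof x).
Definition subalg_scale (c : R[i]) (x : ty) : ty :=
  subalg_in (subalgZ c (subalg_valS x)).
Definition subalg_mul (x y : ty) : ty :=
  subalg_in (subalgM (subalg_valS x) (subalg_valS y)).
Definition subalg_star (x : ty) : ty := subalg_in (subalgS (subalg_valS x)).

Fact subalg_addA : associative subalg_add.
Proof. by move=> x y z; apply: subalg_inj; rewrite /= addrA. Qed.
Fact subalg_addC : commutative subalg_add.
Proof. by move=> x y; apply: subalg_inj; rewrite /= addrC. Qed.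
Fact subalg_add0 : left_id subalg_zero subalg_add.
Proof. by move=> x; apply: subalg_inj; rewrite /= add0r. Qed.
Fact subalg_addN : left_inverse subalg_zero subalg_opp subalg_add.
Proof. by move=> x; apply: subalg_inj; rewrite /= addNr. Qed.

HB.instance Definition _ := GRing.isZmodule.Build ty
  subalg_addA subalg_addC subalg_add0 subalg_addN.

Fact subalg_scaleA c d x :
  subalg_scale c (subalg_scale d x) = subalg_scale (c * d) x.
Proof. by apply: subalg_inj; rewrite /= scalerA. Qed.
Fact subalg_scale1 : left_id 1 subalg_scale.
Proof. by move=> x; apply: subalg_inj; rewrite /= scale1r. Qed.
Fact subalg_scaleDr : right_distributive subalg_scale +%R.
Proof. by move=> c x y; apply: subalg_inj; rewrite /= scalerDr. Qed.
Fact subalg_scaleDl x : {morph subalg_scale^~ x : c d / c + d}.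
Proof. by move=> c d; apply: subalg_inj; rewrite /= scalerDl. Qed.

HB.instance Definition _ := GRing.Zmodule_isLmodule.Build R[i] ty
  subalg_scaleA subalg_scale1 subalg_scaleDr subalg_scaleDl.

HB.instance Definition _ := hasStarOps.Build R ty subalg_mul subalg_star.

Fact subalg_smulA (x y z : ty) : x ** (y ** z) = x ** y ** z.
Proof. by apply: subalg_inj; apply: smulA. Qed.
Fact subalg_smulDl (x y z : ty) : (x + y) ** z = x ** z + y ** z.
Proof. by apply: subalg_inj; apply: smulDl. Qed.
Fact subalg_smulDr (x y z : ty) : x ** (y + z) = x ** y + x ** z.
Proof. by apply: subalg_inj; apply: smulDr. Qed.
Fact subalg_smulZl (c : R[i]) (x y : ty) : (c *: x) ** y = c *: (x ** y).
Proof. by apply: subalg_inj; apply: smulZl. Qed.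
Fact subalg_smulZr (c : R[i]) (x y : ty) : x ** (c *: y) = c *: (x ** y).
Proof. by apply: subalg_inj; apply: smulZr. Qed.
Fact subalg_starK (x : ty) : star (star x) = x.
Proof. by apply: subalg_inj; apply: starK. Qed.
Fact subalg_starD (x y : ty) : star (x + y) = star x + star y.
Proof. by apply: subalg_inj; apply: starD. Qed.
Fact subalg_starZ (c : R[i]) (x : ty) : star (c *: x) = c^* *: star x.
Proof. by apply: subalg_inj; apply: starZ. Qed.
Fact subalg_starM (x y : ty) : star (x ** y) = star y ** star x.
Proof. by apply: subalg_inj; apply: starM. Qed.

HB.instance Definition _ := isStarAlgebra.Build R ty
  subalg_smulA subalg_smulDl subalg_smulDr subalg_smulZl subalg_smulZr
  subalg_starK subalg_starD subalg_starZ subalg_starM.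

Lemma subalg_valD (x y : ty) : subalg_val (x + y) = subalg_val x + subalg_val y.
Proof. by []. Qed.
Lemma subalg_valN (x : ty) : subalg_val (- x) = - subalg_val x.
Proof. by []. Qed.
Lemma subalg_valB (x y : ty) : subalg_val (x - y) = subalg_val x - subalg_val y.
Proof. by []. Qed.
Lemma subalg_val0 : subalg_val (0 : ty) = 0.
Proof. by []. Qed.
Lemma subalg_valZ (c : R[i]) (x : ty) : subalg_val (c *: x) = c *: subalg_val x.
Proof. by []. Qed.

End SubalgType.

Arguments subalg_val {R A S} _.

Section PreCStarTheory.
Variables (R : realType) (B : preCstarType R).
Implicit Types x y : B.

Lemma norm_star x : `|star x| = `|x|.
Proof.
suff le z : `|z| <= `|star z :> B|.
  by apply/eqP; rewrite eq_le le andbT -[leRHS](congr1 _ (starK x)) le.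
have [->|z0] := eqVneq z 0; first by rewrite star0.
rewrite -(ler_pM2r (x := `|z|)) ?normr_gt0//.
by rewrite -expr2 -norm_star_smul norm_smul.
Qed.

Lemma star_continuous : continuous (@star R B : B -> B).
Proof.
move=> x; apply/cvgrPdist_lt => e e0; near=> y.
rewrite -starB norm_star; near: y.
by apply: cvgr_dist_lt.
Unshelve. all: by end_near. Qed.

End PreCStarTheory.

(* The values are extended reals because an operator norm, a supremum, is not
   known a priori to be finite. *)
Definition seminorm_topology (R : realType) (X I : Type) (p : I -> X -> \bar R)
  : Type := X.

Section SeminormTopology.
Variables (R : realType) (X : zmodType) (I : Type) (p : I -> X -> \bar R).

Definition seminorm_ball (i : I) (x : X) (e : R) : set X :=
  [set y | (p i (y - x) < e%:E)%E].

Definition seminorm_subbase : set (set X) :=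
  [set U | exists i x e, 0 < e /\ U = seminorm_ball i x e].

HB.instance Definition _ := Choice.on (seminorm_topology p).
HB.instance Definition _ :=
  isSubBaseTopological.Build (seminorm_topology p) seminorm_subbase id.

End SeminormTopology.

(* Gamma(J): mul_l and mul_r are the maps S and T of the double multiplier. *)
Record multiplier (R : realType) (J : starAlgType R) := Multiplier {
  mul_l : J -> J;
  mul_r : J -> J;
  multiplierP : forall x y, x ** mul_l y = mul_r x ** y }.

Section Multiplier.
Variables (R : realType) (J : starAlgType R).
Local Notation Gamma := (multiplier J).
Implicit Types m n : Gamma.

Lemma multiplier_eq m n : mul_l m = mul_l n -> mul_r m = mul_r n -> m = n.
Proof.
case: m n => [S T p] [U V q] /= SU TV; case: _ / SU q => q.
by case: _ / TV q => q; congr Multiplier; exact: Prop_irrelevance.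
Qed.

HB.instance Definition _ := gen_eqMixin Gamma.
HB.instance Definition _ := gen_choiceMixin Gamma.

Fact mult_zero_subproof (x y : J) : x ** 0 = 0 ** y.
Proof. by rewrite smul0r smul0l. Qed.
Fact mult_opp_subproof m x y : x ** (- mul_l m y) = (- mul_r m x) ** y.
Proof. by rewrite smulNr smulNl multiplierP. Qed.
Fact mult_add_subproof m n x y :
  x ** (mul_l m y + mul_l n y) = (mul_r m x + mul_r n x) ** y.
Proof. by rewrite smulDr smulDl !multiplierP. Qed.
Fact mult_scale_subproof (c : R[i]) m x y :
  x ** (c *: mul_l m y) = (c *: mul_r m x) ** y.
Proof. by rewrite smulZr smulZl multiplierP. Qed.
Fact mult_mul_subproof m n x y :
  x ** mul_l m (mul_l n y) = mul_r n (mul_r m x) ** y.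
Proof. by rewrite !multiplierP. Qed.
Fact mult_star_subproof m x y :
  x ** star (mul_r m (star y)) = star (mul_l m (star x)) ** y.
Proof.
by rewrite -[x in LHS]starK -starM -multiplierP starM starK.
Qed.

Definition mult_zero : Gamma := Multiplier mult_zero_subproof.
Definition mult_opp m : Gamma := Multiplier (mult_opp_subproof m).
Definition mult_add m n : Gamma := Multiplier (mult_add_subproof m n).
Definition mult_scale c m : Gamma := Multiplier (mult_scale_subproof c m).
Definition mult_mul m n : Gamma := Multiplier (mult_mul_subproof m n).
Definition mult_star m : Gamma := Multiplier (mult_star_subproof m).

Fact mult_addA : associative mult_add.
Proof. by move=> x y z; apply: multiplier_eq; apply/funext=> a /=; rewrite addrA. Qed.
Fact mult_addC : commutative mult_add.
Proof. by move=> x y; apply: multiplier_eq; apply/funext=> a /=; rewrite addrC. Qed.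
Fact mult_add0 : left_id mult_zero mult_add.
Proof. by move=> x; apply: multiplier_eq; apply/funext=> a /=; rewrite add0r. Qed.
Fact mult_addN : left_inverse mult_zero mult_opp mult_add.
Proof. by move=> x; apply: multiplier_eq; apply/funext=> a /=; rewrite addNr. Qed.

HB.instance Definition _ := GRing.isZmodule.Build Gamma
  mult_addA mult_addC mult_add0 mult_addN.

Fact mult_scaleA c d m : mult_scale c (mult_scale d m) = mult_scale (c * d) m.
Proof. by apply: multiplier_eq; apply/funext=> a /=; rewrite scalerA. Qed.
Fact mult_scale1 : left_id 1 mult_scale.
Proof. by move=> m; apply: multiplier_eq; apply/funext=> a /=; rewrite scale1r. Qed.
Fact mult_scaleDr : right_distributive mult_scale +%R.
Proof.
by move=> c x y; apply: multiplier_eq; apply/funext=> a /=; rewrite scalerDr.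
Qed.
Fact mult_scaleDl m : {morph mult_scale^~ m : c d / c + d}.
Proof.
by move=> c d; apply: multiplier_eq; apply/funext=> a /=; rewrite scalerDl.
Qed.

HB.instance Definition _ := GRing.Zmodule_isLmodule.Build R[i] Gamma
  mult_scaleA mult_scale1 mult_scaleDr mult_scaleDl.

(* Only the operations are provided: the two maps are not assumed to be linear,
   and distributivity may fail when J has annihilating elements. *)
HB.instance Definition _ := hasStarOps.Build R Gamma mult_mul mult_star.

End Multiplier.

(* For a C*-algebra B, M(B) is Gamma(B) with the norm ||(S, T)|| = ||S||. *)
Definition multiplier_norm (R : realType) (B : preCstarType R)
    (m : multiplier B) : \bar R :=
  ereal_sup [set (rnorm (mul_l m x))%:E | x in [set x | rnorm x <= 1]].

(* K(B), as the minimum dense two-sided ideal; an inhabitant of pedersen B is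
   unique. *)
Definition pedersen_ideal (R : realType) (B : cstarType R) (J : set B) : Prop :=
  [/\ two_sided_ideal J, dense J &
      forall I : set B, two_sided_ideal I -> dense I -> J `<=` I].

Record pedersen (R : realType) (B : cstarType R) := Pedersen {
  pedersen_set :> set B;
  pedersenP : pedersen_ideal pedersen_set }.

Section PedersenAlgebra.
Variables (R : realType) (B : cstarType R) (K : pedersen B).

Fact pedersen0 : (K : set B) 0.
Proof. by have [[]] := pedersenP K. Qed.
Fact pedersenD x y : (K : set B) x -> (K : set B) y -> (K : set B) (x + y).
Proof. by have [[_ KD _ _] _ _] := pedersenP K; exact: KD. Qed.
Fact pedersenZ (c : R[i]) x : (K : set B) x -> (K : set B) (c *: x).
Proof. by have [[_ _ KZ _] _ _] := pedersenP K; exact: KZ. Qed.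
Fact pedersenM x y : (K : set B) x -> (K : set B) y -> (K : set B) (x ** y).
Proof. by have [[_ _ _ KM] _ _] := pedersenP K => Kx _; case: (KM x y Kx). Qed.
Fact pedersenS x : (K : set B) x -> (K : set B) (star x).
Proof.
have [[K0 KD KZ KM] Kd Kmin] := pedersenP K => Kx.
apply: (Kmin (@star R B @^-1` K)) => //; last first.
  move=> O [y Oy] Oop.
  have [||z [/= Oz Kz]] := Kd (@star R B @^-1` O).
  - by exists (star y); rewrite /= starK.
  - by move/continuousP : (@star_continuous R B); apply.
  - by exists (star z); split=> //=; rewrite starK.
split=> /=.
- by rewrite star0.
- by move=> a b Ka Kb; rewrite starD; exact: KD.
- by move=> c a Ka; rewrite starZ; exact: KZ.
- by move=> a b Ka; rewrite !starM; split; [case: (KM _ (star b) Ka)|case: (KM _ (star b) Ka)].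
Qed.

Definition pedersen_subalg : starSubalg B :=
  StarSubalg pedersen0 pedersenD pedersenZ pedersenM pedersenS.

Definition pedersen_alg : Type := subalg_type pedersen_subalg.
HB.instance Definition _ := StarAlgebra.on pedersen_alg.

Definition pedersen_val (x : pedersen_alg) : B := subalg_val x.

(* K(B)^+: positivity is that of B, not of the *-algebra K(B). *)
Definition pedersen_pos : Type := {a : pedersen_alg | positive (pedersen_val a)}.

(* ||S restricted to L_a||, where L_a is the closure of Ba *)
Definition restricted_norm (a : pedersen_pos) (m : multiplier pedersen_alg)
    : \bar R :=
  ereal_sup [set (rnorm (pedersen_val (mul_l m x)))%:E | x in
    [set x | closure [set b ** pedersen_val (sval a) | b in [set: B]]
               (pedersen_val x) /\ rnorm (pedersen_val x) <= 1]].

Definition kappa_seminorm (i : pedersen_alg + pedersen_alg)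
    (m : multiplier pedersen_alg) : \bar R :=
  match i with
  | inl a => (rnorm (pedersen_val (mul_l m a)))%:E
  | inr a => (rnorm (pedersen_val (mul_r m a)))%:E
  end.

Definition Gamma_proj_topology : topologicalType :=
  seminorm_topology restricted_norm.

Definition Gamma_kappa_topology : topologicalType :=
  seminorm_topology kappa_seminorm.

End PedersenAlgebra.

(* A presentation of A as an inverse limit, lproj n being the map pi_n *)
Record sigma_cstar (R : realType) (A : starAlgType R) := SigmaCStar {
  level : nat -> cstarType R;
  conn : forall n, level n.+1 -> level n;
  lproj : forall n, A -> level n;
  conn_hom : forall n, star_hom (conn (n := n));
  lproj_hom : forall n, star_hom (lproj n);
  conn_lproj : forall n a, conn (lproj n.+1 a) = lproj n a;
  lproj_lim : forall x : (forall n, level n),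
    (forall n, conn (x n.+1) = x n) -> exists! a, forall n, lproj n a = x n }.

Section SigmaCStarTheory.
Variables (R : realType) (A : starAlgType R) (P : sigma_cstar A).
Implicit Types a b : A.

Definition lnorm (n : nat) a : \bar R := (rnorm (lproj P n a))%:E.

Definition proj_topology : topologicalType := seminorm_topology lnorm.

Definition infnorm a : \bar R := ereal_sup (range (lnorm^~ a)).

Definition bounded_elt : set A := [set a | (infnorm a < +oo)%E].

Lemma lprojD n a b : lproj P n (a + b) = lproj P n a + lproj P n b.
Proof.
by have [lin _ _] := lproj_hom P n; have := lin 1 a b; rewrite !scale1r.
Qed.

Lemma lproj0 n : lproj P n 0 = 0.
Proof.
by apply: (@addrI _ (lproj P n 0)); rewrite -lprojD !addr0.
Qed.

Lemma lprojZ n (c : R[i]) a : lproj P n (c *: a) = c *: lproj P n a.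
Proof.
have [lin _ _] := lproj_hom P n; have := lin c a 0.
by rewrite addr0 lproj0 addr0.
Qed.

Lemma lprojM n a b : lproj P n (a ** b) = lproj P n a ** lproj P n b.
Proof. by have [_ hM _] := lproj_hom P n. Qed.

Lemma lprojS n a : lproj P n (star a) = star (lproj P n a).
Proof. by have [_ _ hS] := lproj_hom P n. Qed.

Lemma lproj_eq0 a : (forall n, lproj P n a = 0) -> a = 0.
Proof.
move=> a0; have [|b [_ bu]] := @lproj_lim _ _ P (fun=> 0).
  by move=> n; rewrite -[in LHS](lproj0 n.+1) conn_lproj lproj0.
by rewrite -(bu a a0); apply: bu => n; exact: lproj0.
Qed.

Lemma infnorm_ge0 a : (0 <= infnorm a)%E.
Proof.
apply: (@le_trans _ _ (lnorm 0 a)); first by rewrite lee_fin rnorm_ge0.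
by apply: ereal_sup_ubound; exists 0%N.
Qed.

Lemma bounded_eltP a : bounded_elt a <-> exists M, forall n, rnorm (lproj P n a) <= M.
Proof.
split=> [ab|[M aM]].
  exists (fine (infnorm a)) => n; rewrite -lee_fin fineK; last first.
    by rewrite ge0_fin_numE ?infnorm_ge0.
  by apply: ereal_sup_ubound; exists n.
apply: (@le_lt_trans _ _ M%:E); last exact: ltry.
by apply: ge_ereal_sup => _ [n _ <-]; rewrite lee_fin.
Qed.

Lemma infnorm_star a : infnorm (star a) = infnorm a.
Proof.
rewrite /infnorm; suff -> : lnorm^~ (star a) = lnorm^~ a by [].
apply/funext => n; by rewrite /lnorm lprojS /rnorm norm_star.
Qed.

Fact bounded_elt0 : bounded_elt 0.
Proof. by apply/bounded_eltP; exists 0 => n; rewrite lproj0 rnorm0. Qed.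

Fact bounded_eltD a b : bounded_elt a -> bounded_elt b -> bounded_elt (a + b).
Proof.
move=> /bounded_eltP[M aM] /bounded_eltP[N bN]; apply/bounded_eltP.
exists (M + N) => n; rewrite lprojD (le_trans (rnormD _ _))//.
by rewrite lerD.
Qed.

Fact bounded_eltZ (c : R[i]) a : bounded_elt a -> bounded_elt (c *: a).
Proof.
move=> /bounded_eltP[M aM]; apply/bounded_eltP.
exists (Normc.normc c * M) => n; rewrite lprojZ rnormZ.
by rewrite ler_wpM2l// -lecR; exact: (normr_ge0 c).
Qed.

Lemma rnormM (B : preCstarType R) (x y : B) : rnorm (x ** y) <= rnorm x * rnorm y.
Proof. by rewrite -lecR rmorphM /= -!rnormE norm_smul. Qed.

Fact bounded_eltM a b : bounded_elt a -> bounded_elt b -> bounded_elt (a ** b).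
Proof.
move=> /bounded_eltP[M aM] /bounded_eltP[N bN]; apply/bounded_eltP.
exists (M * N) => n; rewrite lprojM (le_trans (rnormM _ _))//.
by apply: ler_pM; [exact: rnorm_ge0|exact: rnorm_ge0|exact: aM|exact: bN].
Qed.

Fact bounded_eltS a : bounded_elt a -> bounded_elt (star a).
Proof. by rewrite /bounded_elt /= infnorm_star. Qed.

Definition bounded_subalg : starSubalg A :=
  StarSubalg bounded_elt0 bounded_eltD bounded_eltZ bounded_eltM bounded_eltS.

(* A_b is also complete: see Ab_complete below for the locally compact case. *)
Definition Ab : Type := subalg_type bounded_subalg.
HB.instance Definition _ := StarAlgebra.on Ab.

Definition Ab_val (x : Ab) : A := subalg_val x.
Definition Ab_norm (x : Ab) : R := fine (infnorm (Ab_val x)).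

Lemma Ab_valS (x : Ab) : bounded_elt (Ab_val x).
Proof. exact: (@subalg_valS R A bounded_subalg x). Qed.

Lemma Ab_normE (x : Ab) : (Ab_norm x)%:E = infnorm (Ab_val x).
Proof.
by rewrite fineK// ge0_fin_numE ?infnorm_ge0//; exact: (@Ab_valS x).
Qed.

Lemma Ab_norm_ge (x : Ab) n : rnorm (lproj P n (Ab_val x)) <= Ab_norm x.
Proof. by rewrite -lee_fin Ab_normE; apply: ereal_sup_ubound; exists n. Qed.

Lemma Ab_norm_le (x : Ab) (M : R) :
  (forall n, rnorm (lproj P n (Ab_val x)) <= M) -> Ab_norm x <= M.
Proof.
move=> xM; rewrite -lee_fin Ab_normE.
by apply: ge_ereal_sup => _ [n _ <-]; rewrite lee_fin.
Qed.

Lemma Ab_norm_ge0 (x : Ab) : 0 <= Ab_norm x.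
Proof. exact: le_trans (rnorm_ge0 _) (Ab_norm_ge x 0). Qed.

Fact Ab_normD (x y : Ab) :
  ((Ab_norm (x + y))%:C <= (Ab_norm x)%:C + (Ab_norm y)%:C)%C.
Proof.
rewrite -rmorphD lecR; apply: Ab_norm_le => n.
by rewrite lprojD (le_trans (rnormD _ _))// lerD// Ab_norm_ge.
Qed.

Fact Ab_normZ (c : R[i]) (x : Ab) :
  ((Ab_norm (c *: x))%:C = `|c| * (Ab_norm x)%:C)%C.
Proof.
have nc_ge0 (d : R[i]) : 0 <= Normc.normc d by rewrite -lecR; exact: (normr_ge0 d).
have leZ (d : R[i]) (y : Ab) : Ab_norm (d *: y) <= Normc.normc d * Ab_norm y.
  apply: Ab_norm_le => n; rewrite lprojZ rnormZ.
  by rewrite ler_wpM2l// Ab_norm_ge.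
rewrite -[`|c|]/((Normc.normc c)%:C)%C -rmorphM; congr ((_)%:C)%C.
apply/eqP; rewrite eq_le leZ andTb.
have [->|c0] := eqVneq c 0; first by rewrite Normc.normc0 mul0r Ab_norm_ge0.
have cp : 0 < Normc.normc c.
  by rewrite lt0r nc_ge0 andbT; apply: contra c0 => /eqP /Normc.eq0_normc ->.
rewrite -ler_pdivlMl//; have := leZ c^-1 (c *: x).
by rewrite scalerA mulVf// scale1r Normc.normcV.
Qed.

Fact Ab_norm_eq0 (x : Ab) : ((Ab_norm x)%:C = 0)%C -> x = 0.
Proof.
move=> /complexI x0; apply: subalg_inj; apply: lproj_eq0 => n.
apply: rnorm_eq0; apply/eqP; rewrite eq_le rnorm_ge0 andbT.
by rewrite -x0; exact: Ab_norm_ge.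
Qed.

HB.instance Definition _ := Lmodule_isNormed.Build R[i] Ab
  Ab_normD Ab_normZ Ab_norm_eq0.

Lemma Ab_normrE (x : Ab) : `|x| = ((Ab_norm x)%:C)%C.
Proof. by []. Qed.

Lemma Ab_rnormE (x : Ab) : rnorm x = Ab_norm x.
Proof. by []. Qed.

Fact Ab_norm_smul (x y : Ab) : `|x ** y| <= `|x| * `|y|.
Proof.
rewrite !Ab_normrE -rmorphM lecR; apply: Ab_norm_le => n.
by rewrite lprojM (le_trans (rnormM _ _))//; apply: ler_pM; first [exact: rnorm_ge0|exact: Ab_norm_ge].
Qed.

Fact Ab_norm_star_smul (x : Ab) : `|star x ** x| = `|x| ^+ 2.
Proof.
have sqr n : rnorm (lproj P n (Ab_val (star x ** x))) = rnorm (lproj P n (Ab_val x)) ^+ 2.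
  apply: complexI; rewrite lprojM lprojS rmorphXn /= -!rnormE.
  exact: norm_star_smul.
rewrite !Ab_normrE -rmorphXn; congr ((_)%:C)%C; apply/eqP; rewrite eq_le.
apply/andP; split.
  apply: Ab_norm_le => n; rewrite sqr.
  by rewrite ler_sqr ?nnegrE ?rnorm_ge0 ?Ab_norm_ge0// Ab_norm_ge.
rewrite -[leRHS]sqr_sqrtr ?Ab_norm_ge0//.
rewrite ler_sqr ?nnegrE ?sqrtr_ge0 ?Ab_norm_ge0//.
apply: Ab_norm_le => n.
by rewrite -(ler_sqr (rnorm_ge0 _)) ?nnegrE ?sqrtr_ge0// sqr_sqrtr ?Ab_norm_ge0// -sqr Ab_norm_ge.
Qed.

HB.instance Definition _ := isPreCStar.Build R Ab Ab_norm_smul Ab_norm_star_smul.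

Definition to_Ab a (ab : bounded_elt a) : Ab := @subalg_in R A bounded_subalg a ab.

End SigmaCStarTheory.

Record mb_seq (R : realType) (A : starAlgType R) (P : sigma_cstar A) := MbSeq {
  mb_elt :> nat -> A;
  mb_pos : forall n, positive (mb_elt n);
  mb_bounded : forall n a, bounded_elt P (a ** mb_elt n) }.

Section SupportAlgebra.
Variables (R : realType) (A : starAlgType R) (P : sigma_cstar A) (e : mb_seq P).

Definition A00 : set A := [set x | exists n,
  lspan [set y | exists b c, y = b ** (e n ** e n) ** c] x].

Lemma A00_mull a x : A00 x -> A00 (a ** x).
Proof.
move=> [n xn]; exists n; move: x xn; apply: lspan_ind => [|x y|c x|x].
- by rewrite smul0r; exact: lspan0.
- by rewrite smulDr; exact: lspanD.
- by rewrite smulZr; exact: lspanZ.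
- move=> [b [c ->]]; apply: lspan_sub; exists (a ** b), c.
  by rewrite !smulA.
Qed.

Lemma A00_mulr a x : A00 x -> A00 (x ** a).
Proof.
move=> [n xn]; exists n; move: x xn; apply: lspan_ind => [|x y|c x|x].
- by rewrite smul0l; exact: lspan0.
- by rewrite smulDl; exact: lspanD.
- by rewrite smulZl; exact: lspanZ.
- move=> [b [c ->]]; apply: lspan_sub; exists b, (c ** a).
  by rewrite !smulA.
Qed.

Lemma A00_star x : A00 x -> A00 (star x).
Proof.
move=> [n xn]; exists n; move: x xn; apply: lspan_ind => [|x y|c x|x].
- by rewrite star0; exact: lspan0.
- by rewrite starD; exact: lspanD.
- by rewrite starZ; exact: lspanZ.
- move=> [b [c ->]]; apply: lspan_sub; exists (star c), (star b).
  by rewrite !starM (positive_star (mb_pos e n)) !smulA.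
Qed.

Lemma A00_bounded x : A00 x -> bounded_elt P x.
Proof.
move=> [n]; move: x; apply: lspan_ind => [|x y|c x|x].
- exact: bounded_elt0.
- exact: bounded_eltD.
- exact: bounded_eltZ.
- move=> [b [c ->]]; rewrite smulA -(smulA (b ** e n)); apply: bounded_eltM.
    exact: mb_bounded.
  rewrite -[e n ** c]starK starM (positive_star (mb_pos e n)).
  exact/bounded_eltS/mb_bounded.
Qed.

Definition A00_mul (i : {x | A00 x} + {x | A00 x}) (a : A) : Ab P :=
  match i with
  | inl x => to_Ab (A00_bounded (A00_mulr a (svalP x)))
  | inr x => to_Ab (A00_bounded (A00_mull a (svalP x)))
  end.

(* The weakest topology, and uniformity, making all the maps A00_mul i
   continuous *)
Definition A00_topology : uniformType :=
  sup_topology (fun i => Uniform.class (initial_topology (A00_mul i))).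

End SupportAlgebra.

(* A unital sigma-C*-algebra is locally compact if it has such a structure. *)
Record lc_sigma_cstar (R : realType) (A : starAlgType R) := LocallyCompact {
  lc_sigma :> sigma_cstar A;
  lc_one : A;
  lc_oneP : forall a, lc_one ** a = a /\ a ** lc_one = a;
  lc_surj : forall n (y : level lc_sigma n), exists a, lproj lc_sigma n a = y;
  lc_seq : mb_seq lc_sigma;
  lc_canonical : forall n m, (n < m)%N -> lc_seq m ** lc_seq n = lc_seq n;
  lc_le1 : forall n, positive (lc_one - lc_seq n);
  lc_cvg : (fun n => lc_seq n : A00_topology lc_seq) @ \oo -->
           (lc_one : A00_topology lc_seq);
  lc_complete : forall F : set_system (A00_topology lc_seq),
    ProperFilter F -> cauchy F -> exists a : A00_topology lc_seq, F --> a;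
  lc_lower : forall n a,
    (lnorm lc_sigma n a <=
      ereal_sup [set infnorm lc_sigma (lc_seq n ** b ** a) |
                 b in [set b | infnorm lc_sigma (lc_seq n ** b) <= 1]])%E;
  lc_upper : forall n a,
    (infnorm lc_sigma (lc_seq n ** a) <= lnorm lc_sigma n a)%E }.

Section ClosureSubalg.
Variables (R : realType) (B : preCstarType R) (S : starSubalg B).
Local Notation clS := (closure (S : set B)).

Lemma closure_normP (x : B) :
  clS x <-> forall e : R[i], 0 < e -> exists2 y, (S : set B) y & `|x - y| < e.
Proof.
split=> [Sx e e0|Sx U /nbhs_ballP[e /= e0 xeU]].
  have [|y [Sy xy]] := Sx (ball x e); first exact: nbhsx_ballx.
  by exists y => //; move: xy; rewrite -ball_normE.
have [y Sy xy] := Sx e e0; exists y; split=> //.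
by apply: xeU; rewrite -ball_normE.
Qed.

Fact closure_subalg0 : clS 0.
Proof. exact/subset_closure/subalg0. Qed.

Fact closure_subalgD x y : clS x -> clS y -> clS (x + y).
Proof.
move=> /closure_normP Sx /closure_normP Sy; apply/closure_normP => e e0.
have e20 : 0 < e / 2 by rewrite divr_gt0.
have [x' Sx' xx'] := Sx _ e20; have [y' Sy' yy'] := Sy _ e20.
exists (x' + y'); first exact: subalgD.
rewrite opprD addrACA (le_lt_trans (ler_normD _ _))//.
by rewrite [ltRHS](splitr e) ltrD.
Qed.

Fact closure_subalgZ (c : R[i]) x : clS x -> clS (c *: x).
Proof.
move=> /closure_normP Sx; apply/closure_normP => e e0.
have c0 : 0 < `|c| + 1 by rewrite ltr_wpDl.
have [|y Sy xy] := Sx (e / (`|c| + 1)); first by rewrite divr_gt0.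
exists (c *: y); first exact: subalgZ.
rewrite -scalerBr normrZ (@le_lt_trans _ _ ((`|c| + 1) * `|x - y|))//.
  by rewrite ler_wpM2r// lerDl.
by rewrite mulrC -ltr_pdivlMr.
Qed.

Fact closure_subalgS x : clS x -> clS (star x).
Proof.
move=> /closure_normP Sx; apply/closure_normP => e e0.
have [y Sy xy] := Sx e e0; exists (star y); first exact: subalgS.
by rewrite -starB norm_star.
Qed.

Fact closure_subalgM x y : clS x -> clS y -> clS (x ** y).
Proof.
move=> /closure_normP Sx /closure_normP Sy; apply/closure_normP => e e0.
have e20 : 0 < e / 2 by rewrite divr_gt0.
have y0 : 0 < `|y| + 1 by rewrite ltr_wpDl.
have [|x' Sx' xx'] := Sx (e / 2 / (`|y| + 1)); first by rewrite divr_gt0.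
have x0 : 0 < `|x'| + 1 by rewrite ltr_wpDl.
have [|y' Sy' yy'] := Sy (e / 2 / (`|x'| + 1)); first by rewrite divr_gt0.
exists (x' ** y'); first exact: subalgM.
have -> : x ** y - x' ** y' = (x - x') ** y + x' ** (y - y').
  by rewrite smulBl smulBr addrA subrK.
rewrite (le_lt_trans (ler_normD _ _))// [ltRHS](splitr e) ltrD//.
  rewrite (le_lt_trans (norm_smul _ _))//.
  rewrite (@le_lt_trans _ _ (`|x - x'| * (`|y| + 1)))//.
    by rewrite ler_wpM2l// lerDl.
  by rewrite -ltr_pdivlMr.
rewrite (le_lt_trans (norm_smul _ _))//.
rewrite (@le_lt_trans _ _ ((`|x'| + 1) * `|y - y'|))//.
  by rewrite ler_wpM2r// lerDl.
by rewrite mulrC -ltr_pdivlMr.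
Qed.

Definition closure_subalg : starSubalg B := StarSubalg closure_subalg0
  closure_subalgD closure_subalgZ closure_subalgM closure_subalgS.

Definition closure_alg : Type := subalg_type closure_subalg.
HB.instance Definition _ := StarAlgebra.on closure_alg.

Definition closure_val (x : closure_alg) : B := subalg_val x.

Fact closure_alg_normD (x y : closure_alg) :
  `|closure_val (x + y)| <= `|closure_val x| + `|closure_val y|.
Proof. exact: ler_normD. Qed.
Fact closure_alg_normZ (c : R[i]) (x : closure_alg) :
  `|closure_val (c *: x)| = `|c| * `|closure_val x|.
Proof. exact: normrZ. Qed.
Fact closure_alg_norm_eq0 (x : closure_alg) : `|closure_val x| = 0 -> x = 0.
Proof. by move=> /normr0_eq0 x0; apply: subalg_inj. Qed.

HB.instance Definition _ := Lmodule_isNormed.Build R[i] closure_alg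
  closure_alg_normD closure_alg_normZ closure_alg_norm_eq0.

Fact closure_alg_norm_smul (x y : closure_alg) : `|x ** y| <= `|x| * `|y|.
Proof. exact: (norm_smul (closure_val x) (closure_val y)). Qed.
Fact closure_alg_norm_star_smul (x : closure_alg) : `|star x ** x| = `|x| ^+ 2.
Proof. exact: (norm_star_smul (closure_val x)). Qed.

HB.instance Definition _ := isPreCStar.Build R closure_alg
  closure_alg_norm_smul closure_alg_norm_star_smul.

Lemma closure_alg_complete :
  (forall F : set_system B, ProperFilter F -> cauchy F -> exists b : B, F --> b) ->
  forall F : set_system closure_alg, ProperFilter F -> cauchy F -> cvg F.
Proof.
move=> Bc F FF Fc.
have Gc : cauchy (closure_val @ F).
  apply/cauchyP => e e0; have /cauchyP /(_ e e0)[x Fx] := Fc.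
  exists (closure_val x).
  suff : F (closure_val @^-1` ball (closure_val x) e) by [].
  by apply: filterS Fx => y; rewrite /= -!ball_normE => xy; exact: xy.
have [b Fb] := Bc _ _ Gc.
have Sb : (closure_subalg : set B) b.
  have clE := (closure_id clS).1 (@closed_closure B S).
  suff : closure clS b by rewrite -clE.
  move=> U Ub.
  have [x Ux] : exists x, U (closure_val x).
    exact: (filter_ex (Fb U Ub : F (closure_val @^-1` U))).
  by exists (closure_val x); split=> //; exact: (subalg_valS (x : subalg_type closure_subalg)).
apply/cvg_ex; exists (subalg_in Sb : closure_alg).
apply/cvgrPdist_lt => e e0.
by have /cvgrPdist_lt /(_ e e0) := Fb.
Qed.

End ClosureSubalg.

Lemma sup_initial_cvg (S : choiceType) (Y : uniformType) (I : Type)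
    (f : I -> S -> Y) (F : set_system S) (a : S) : Filter F ->
  F --> (a : sup_topology (fun i => Uniform.class (initial_topology (f i)))) ->
  forall i, f i @ F --> f i a.
Proof.
move=> FF Fa i.
have Fi : F --> (a : initial_topology (f i)).
  exact: (@cvg_sup S _ (fun i => Uniform.class (initial_topology (f i)))
    F a _).1 Fa i.
move=> U Ua; apply: Fi.
exact: (@initial_continuous S Y (f i) a U Ua).
Qed.

Section LocallyCompact.
Variables (R : realType) (A : starAlgType R) (L : lc_sigma_cstar A).
Local Notation e := (lc_seq L).
Local Notation J := (A00 e).

Lemma lc_canonical_r n m : (n < m)%N -> e n ** e m = e n.
Proof.
move=> nm; have := congr1 star (lc_canonical L nm).
by rewrite starM !(positive_star (mb_pos e _)).
Qed.

Lemma A00_level_le n m x : (n <= m)%N ->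
  lspan [set y | exists b c, y = b ** (e n ** e n) ** c] x ->
  lspan [set y | exists b c, y = b ** (e m ** e m) ** c] x.
Proof.
rewrite leq_eqVlt => /orP[/eqP -> //|nm].
move: x; apply: lspan_ind => [|x y|c x|x].
- exact: lspan0.
- exact: lspanD.
- exact: lspanZ.
- move=> [b [c ->]]; apply: lspan_sub; exists (b ** e n), (e n ** c).
  rewrite !smulA -[b ** e n ** e m]smulA (lc_canonical_r nm).
  by rewrite -[b ** e n ** e m]smulA (lc_canonical_r nm).
Qed.

Lemma A00_add x y : J x -> J y -> J (x + y).
Proof.
move=> [n xn] [m ym]; exists (maxn n m); apply: lspanD.
  by apply: A00_level_le xn; exact: leq_maxl.
by apply: A00_level_le ym; exact: leq_maxr.
Qed.

Lemma A00_e n b : J (e n ** b).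
Proof.
exists n.+1; apply: lspan_sub; exists (e n), b.
by rewrite smulA !(lc_canonical_r (ltnSn n)).
Qed.

Let Jb : set (Ab L) := [set x | J (Ab_val x)].

Fact A00b0 : Jb 0.
Proof. by exists 0%N; exact: lspan0. Qed.
Fact A00bD x y : Jb x -> Jb y -> Jb (x + y).
Proof. exact: A00_add. Qed.
Fact A00bZ (c : R[i]) x : Jb x -> Jb (c *: x).
Proof. by move=> [n xn]; exists n; exact: lspanZ. Qed.
Fact A00bM x y : Jb x -> Jb y -> Jb (x ** y).
Proof. by move=> Jx _; exact: A00_mulr. Qed.
Fact A00bS x : Jb x -> Jb (star x).
Proof. exact: A00_star. Qed.

Definition A00_subalg : starSubalg (Ab L) :=
  StarSubalg A00b0 A00bD A00bZ A00bM A00bS.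

Lemma A00_mul_lip (i : {x | J x} + {x | J x}) : exists x : Ab L,
  forall y z : Ab L,
    `|A00_mul i (Ab_val y) - A00_mul i (Ab_val z)| <= `|x| * `|y - z|.
Proof.
case: i => x; exists (to_Ab (A00_bounded (svalP x))) => y z.
  apply: le_trans (norm_smul _ _).
  suff -> : A00_mul (inl x) (Ab_val y) - A00_mul (inl x) (Ab_val z) =
    to_Ab (A00_bounded (svalP x)) ** (y - z) by [].
  by apply: subalg_inj; rewrite /= smulBr.
rewrite mulrC; apply: le_trans (norm_smul _ _).
suff -> : A00_mul (inr x) (Ab_val y) - A00_mul (inr x) (Ab_val z) =
  (y - z) ** to_Ab (A00_bounded (svalP x)) by [].
by apply: subalg_inj; rewrite /= smulBl.
Qed.

Lemma cauchy_A00 (F : set_system (Ab L)) : ProperFilter F -> cauchy F ->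
  @cauchy (A00_topology e) ((@Ab_val R A L) @ F).
Proof.
move=> FF Fc E [D [W WD <-] DE].
apply: (filterS DE).
apply: filter_bigI => p _; case: p => [[i V] pV] /=.
have [V' V'ent V'V] := asboolW pV.
suff VV : filter_prod (@Ab_val R A L @ F) (@Ab_val R A L @ F)
    ((fun ab => (A00_mul i ab.1, A00_mul i ab.2)) @^-1` V').
  case: VV => -[P Q] PQ PQV; exists (P, Q) => // ab /PQV; exact: V'V.
have : cauchy (A00_mul i \o @Ab_val R A L @ F).
  apply/cauchyP => d d0.
  have [x xP] := A00_mul_lip i.
  have x0 : 0 < `|x| + 1 by rewrite ltr_wpDl.
  have /cauchyP /(_ (d / (`|x| + 1))) [|y Fy] := Fc; first by rewrite divr_gt0.
  exists (A00_mul i (Ab_val y)).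
  suff : F ((A00_mul i \o @Ab_val R A L) @^-1` ball (A00_mul i (Ab_val y)) d) by [].
  apply: filterS Fy => z; rewrite /= -!ball_normE /= => yz.
  apply: (le_lt_trans (xP _ _)).
  rewrite (@le_lt_trans _ _ ((`|x| + 1) * `|y - z|))//.
    by rewrite ler_wpM2r// lerDl.
  by rewrite mulrC -ltr_pdivlMr.
move=> /(_ V' V'ent).
move=> [[P Q] /= [FP FQ] PQV].
exists ((A00_mul i) @^-1` P, (A00_mul i) @^-1` Q) => //=.
move=> -[a b] [/= Pa Qb].
exact: (PQV (A00_mul i a, A00_mul i b)).
Qed.

Lemma infnormD (a b : A) :
  (infnorm L (a + b)%R <= infnorm L a + infnorm L b)%E.
Proof.
apply: ge_ereal_sup => _ [n _ <-]; rewrite /lnorm lprojD.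
apply: (@le_trans _ _ (lnorm L n a + lnorm L n b)%E).
  by rewrite lee_fin rnormD.
by apply: leeD; apply: ereal_sup_ubound; exists n.
Qed.

Lemma infnorm_Ab (x : Ab L) (d : R) :
  (`|x| <= ((d)%:C)%C) = (infnorm L (Ab_val x) <= d%:E)%E.
Proof. by rewrite Ab_normrE lecR -Ab_normE lee_fin. Qed.

Lemma A00_cvg (F : set_system (Ab L)) (a : A) : ProperFilter F ->
    (@Ab_val R A L @ F) --> (a : A00_topology e) ->
  forall (x : {x | J x}) (d : R), 0 < d ->
    exists2 U, F U & forall f, U f ->
      (infnorm L (sval x ** (a - Ab_val f))%R <= d%:E)%E.
Proof.
move=> FF Fa x d d0; pose h := @A00_mul _ _ _ e (inl x).
have hF : h @ (@Ab_val R A L @ F) --> h a.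
  exact: (@sup_initial_cvg A (Ab L) _ (@A00_mul R A L e)
    (@Ab_val R A L @ F) a _ Fa (inl x)).
have dC : 0 < ((d)%:C)%C by rewrite ltcR.
pose B : set (Ab L) := ball (h a) (((d)%:C)%C : R[i]).
have FU : F (@Ab_val R A L @^-1` (h @^-1` B)).
  exact: (hF B (nbhsx_ballx (h a) _ dC)).
exists (@Ab_val R A L @^-1` (h @^-1` B)) => // f; rewrite /B /=.
rewrite -ball_normE /= => /ltW; rewrite infnorm_Ab.
suff -> : Ab_val (h a - h (Ab_val f)) = sval x ** (a - Ab_val f) by [].
by rewrite smulBr.
Qed.

Lemma Ab_complete (F : set_system (Ab L)) :
  ProperFilter F -> cauchy F -> exists b : Ab L, F --> b.
Proof.
move=> FF Fc.
have [a Fa] := @lc_complete _ _ L _ (fmap_proper_filter _ FF) (cauchy_A00 FF Fc).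
have le2 (d : R) : 0 < d -> exists2 U, F U & forall f, U f ->
    (infnorm L (a - Ab_val f)%R <= (d + d)%:E)%E.
  move=> d0.
  have dC : 0 < ((d / 2)%:C)%C by rewrite ltcR divr_gt0.
  have /cauchyP /(_ _ dC) [g Fg] := Fc.
  exists (ball g (((d / 2)%:C)%C : R[i])) => // f.
  rewrite -ball_normE /= => gf.
  apply: ge_ereal_sup => _ [n _ <-]; apply: (le_trans (lc_lower L n _)).
  apply: ge_ereal_sup => _ [b /= eb <-].
  have [U FU UP] := A00_cvg FF Fa (exist _ _ (A00_e n b)) d0.
  have [u [Uu gu]] : exists u, U u /\ ball g (((d / 2)%:C)%C : R[i]) u.
    exact: (filter_ex (filterI FU Fg)).
  have -> : e n ** b ** (a - Ab_val f) =
      e n ** b ** (a - Ab_val u) + e n ** b ** (Ab_val (u - f)).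
    by rewrite -smulDr addrA subrK.
  apply: (le_trans (infnormD _ _)); rewrite EFinD; apply: leeD; first exact: UP.
  pose x : Ab L := to_Ab (A00_bounded (A00_e n b)).
  rewrite -[X in infnorm L X]/(Ab_val (x ** (u - f))) -infnorm_Ab.
  apply: (le_trans (norm_smul _ _)).
  have x1 : `|x| <= 1 by rewrite -[1]/((1)%:C)%C infnorm_Ab.
  rewrite -[X in _ <= X]mul1r; apply: ler_pM => //.
  rewrite -[u](subrK g) -addrA (le_trans (ler_normD _ _))//.
  rewrite (splitr d) rmorphD lerD//; last exact: ltW.
  by move: gu; rewrite -ball_normE /= distrC => /ltW.
have ab : bounded_elt L a.
  have [U FU UP] := le2 1 ltr01; have [u Uu] := filter_ex FU.
  rewrite -[a](subrK (Ab_val u)); apply: bounded_eltD; last exact: Ab_valS.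
  exact: (le_lt_trans (UP u Uu) (ltry _)).
exists (to_Ab ab); apply/cvgrPdist_le => d d0.
have dE : d = ((complex.Re d)%:C)%C.
  by move: d0; case: d => x y; rewrite ltcE /= => /andP[/eqP -> _].
have rd0 : 0 < complex.Re d / 2.
  by rewrite divr_gt0//; move: d0; rewrite {1}dE ltcR.
have [U FU UP] := le2 _ rd0.
apply: filterS FU => f /UP; rewrite -splitr => Uf.
by rewrite dE infnorm_Ab.
Qed.

(* The closure of A_00 in A_b *)
Definition A0 : Type := closure_alg A00_subalg.
HB.instance Definition _ := PreCStar.on A0.

Fact A0_complete (F : set_system A0) : ProperFilter F -> cauchy F -> cvg F.
Proof. exact: (closure_alg_complete Ab_complete). Qed.

HB.instance Definition _ := Uniform_isComplete.Build A0 A0_complete.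

Definition A0_val (x : A0) : A := Ab_val (closure_val x).

End LocallyCompact.

(* Main.v *)
(** Since e_n = e_n e_(n+1), each e_n lies in A_00 and a Neumann series shows that
    it lies in every dense ideal of A_0; hence A_00 = K(A_0).  A double multiplier
    (S, T) of A_00 is bounded on each { y | y e_k = y } by the uniform boundedness
    principle, so that S(e_n) is Cauchy in the A_00-topology and its limit
    implements (S, T).  On the ideal generated by e_n the map pi_n is isometric:
    if h is self-adjoint in it, then |h|^N = |h^N| <= C |pi_n h|^(N-1) for N a power
    of 2.  This identifies the projective topologies.

    For the uniqueness, K(C_0) and K(D_0) are both ideals of A.  The C*-algebra C_0
    has approximate units in K(C_0), obtained as 1 minus the ergodic means of
    1 - i d h with h self-adjoint in K(C_0); they converge to 1 in the common
    topology, whence each of the two ideals contains the other.  Continuity and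
    the same power argument show that the two norms agree on them. *)

(* No functional calculus enters: norms are compared through the C*-identity alone. For self-adjoint
   [h] it gives [|h^(2^k)| = |h|^(2^k)], so a bound on powers up to a constant becomes a bound with
   constant 1 after taking roots. The approximate units built from ergodic means need not be
   contractions; that [1 - f] has norm at most a power of [expR 1] is enough to combine them over a
   finite list.

   A double multiplier is a pair of bare maps on an ideal that need not be complete. Linearity is
   recovered by cancellation. Boundedness is obtained only on the pieces { y | y e_k = y }, because
   the map y |-> y e_k reaches them from A_0, which is complete.

   For uniqueness, composing the two homeomorphisms turns the topological hypothesis into
   inequalities between finite sums of kappa-seminorms, in both directions. What remains is algebra
   and norm estimates inside A. *)
Require Import Defs.
From mathcomp Require Import all_boot all_order all_algebra.
From mathcomp Require Import all_classical all_reals all_analysis finmap.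
From mathcomp Require Import complex ring lra.

Set Implicit Arguments.
Unset Strict Implicit.
Unset Printing Implicit Defensive.

Import Order.TTheory GRing.Theory Num.Theory.
Import numFieldNormedType.Exports.

Local Open Scope classical_set_scope.
Local Open Scope ring_scope.

(** * Norms and sequences *)

Section RealLemmas.
Variable R : realType.

Lemma half_gt0 (e : R) : 0 < e -> 0 < e / 2.
Proof. by move=> e0; rewrite divr_gt0. Qed.

(** Bernoulli's inequality [1 + n d <= (1 + d)^n]. *)
Lemma exp_unbounded (d C : R) : 0 < d -> exists n : nat, C < (1 + d) ^+ n.
Proof.
move=> d0; have [n Cn] : exists n : nat, C / d < n%:R.
  by exists (Num.truncn (C / d)).+1; exact: truncnS_gt.
exists n; apply: (@lt_le_trans _ _ (1 + d *+ n)).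
  by rewrite -mulr_natl ltr_wpDl// -ltr_pdivrMr.
elim: n {Cn} => [|n ih]; first by rewrite mulr0n addr0 expr0.
rewrite exprS mulrSr.
have d2 : 0 <= d * (d *+ n) by rewrite mulr_ge0 ?mulrn_wge0 ?ltW.
have := ler_wpM2l (_ : 0 <= 1 + d) ih.
by move=> /(_ (addr_ge0 ler01 (ltW d0))); move: (_ ^+ _) (d *+ _) d2 => x y; nra.
Qed.

(** If [r > s > 0], the powers of [r / s] are unbounded, whereas the hypothesis keeps those of
    exponent [2^k] below [C / s]. Only these exponents appear, since they are the ones that the
    C*-identity computes. *)
Lemma le_of_pow2_le (r s C : R) : 0 <= r -> 0 <= s ->
  (forall k, r ^+ (2 ^ k) <= C * s ^+ (2 ^ k).-1) -> r <= s.
Proof.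
move=> r0 s0 h; rewrite leNgt; apply/negP => sr.
have rp : 0 < r by exact: le_lt_trans s0 sr.
move: s0; rewrite le0r => /orP[/eqP s_0|sp].
  (* The case [k = 0] would say nothing here, as [0 ^+ 0 = 1]. *)
  have := h 1%N; rewrite s_0 expn1 expr1 mulr0 => /(lt_le_trans (exprn_gt0 2 rp)).
  by rewrite ltxx.
have d0 : 0 < r / s - 1 by rewrite subr_gt0 ltr_pdivlMr// mul1r.
have [n nC] := exp_unbounded (C / s) d0.
have kn : (n <= 2 ^ n)%N by apply/ltnW/ltn_expl.
have := h n; apply/negP; rewrite -ltNge.
have -> : C * s ^+ (2 ^ n).-1 = C / s * s ^+ (2 ^ n).
  by rewrite -[in RHS](prednK (expn_gt0 2 n)) exprS mulrA divfK ?gt_eqF.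
rewrite -ltr_pdivlMr ?exprn_gt0// -expr_div_n (lt_le_trans nC)//.
have -> : 1 + (r / s - 1) = r / s by rewrite addrC subrK.
by rewrite ler_weXn2l// ler_pdivlMr// mul1r ltW.
Qed.

End RealLemmas.

Section NormSequences.
Variables (R : realType).

(** Convergence with real tolerances; those of the filter convergence are positive elements of
    [R[i]]. [cvg_rcvg] identifies the two. *)
Definition rcvg (V : normedModType R[i]) (u : nat -> V) (l : V) :=
  forall e : R, 0 < e -> exists N, forall n, (N <= n)%N -> rnorm (u n - l) < e.

Section Normed.
Variable V : normedModType R[i].
Implicit Types x y z : V.

Lemma rnormN x : rnorm (- x) = rnorm x.
Proof. by rewrite /rnorm normrN. Qed.

Lemma rnorm_dist x y : rnorm (x - y) = rnorm (y - x).
Proof. by rewrite -rnormN opprB. Qed.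

Lemma rnormB x y : rnorm (x - y) <= rnorm x + rnorm y.
Proof. by rewrite -(rnormN y) rnormD. Qed.

Lemma rnorm_triangle y x z : rnorm (x - z) <= rnorm (x - y) + rnorm (y - z).
Proof. by apply: le_trans (rnormD _ _); rewrite addrA subrK. Qed.

Lemma ltr_norm_rnorm x (e : R[i]) : 0 < e -> (`|x| < e) = (rnorm x < complex.Re e).
Proof.
case: e => a b; rewrite ltcE /= => /andP[/eqP -> _].
by rewrite rnormE -ltcR.
Qed.

Lemma rnorm_small_eq0 x : (forall e : R, 0 < e -> rnorm x < e) -> x = 0.
Proof.
move=> h; apply: rnorm_eq0; apply/eqP; rewrite eq_le rnorm_ge0 andbT leNgt.
by apply/negP => /h; rewrite ltxx.
Qed.

Lemma normc_real (r : R) : 0 <= r -> Normc.normc ((r)%:C)%C = r.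
Proof. by move=> r0; rewrite /= expr0n addr0 sqrtr_sqr ger0_norm. Qed.

Lemma rnormZr (r : R) x : 0 <= r -> rnorm (((r)%:C)%C *: x) = r * rnorm x.
Proof. by move=> r0; rewrite rnormZ normc_real. Qed.

Lemma normc_ge0 (c : R[i]) : 0 <= Normc.normc c.
Proof. by rewrite -lecR; exact: (normr_ge0 c). Qed.

Lemma rcvg_unique (u : nat -> V) x y : rcvg u x -> rcvg u y -> x = y.
Proof.
move=> ux uy; apply/eqP; rewrite -subr_eq0; apply/eqP/rnorm_small_eq0 => e e0.
have [N hN] := ux _ (half_gt0 e0); have [M hM] := uy _ (half_gt0 e0).
apply: (le_lt_trans (rnorm_triangle (u (maxn N M)) _ _)).
rewrite [ltRHS](splitr e) ltrD//; last by rewrite hM ?leq_maxr.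
by rewrite rnorm_dist hN ?leq_maxl.
Qed.

Lemma rcvg_le (u : nat -> V) x (C : R) : rcvg u x ->
  (forall n, rnorm (u n) <= C) -> rnorm x <= C.
Proof.
move=> ux uC; rewrite leNgt; apply/negP => Cx.
have [N /(_ N (leqnn N)) hN] := ux (rnorm x - C) (ltac:(by rewrite subr_gt0)).
have := rnormB (u N) (u N - x); rewrite subKr.
by have := uC N; move: hN; lra.
Qed.

Lemma rcvgD (u v : nat -> V) x y : rcvg u x -> rcvg v y ->
  rcvg (fun n => u n + v n) (x + y).
Proof.
move=> ux vy e e0.
have [N hN] := ux _ (half_gt0 e0); have [M hM] := vy _ (half_gt0 e0).
exists (maxn N M) => n; rewrite geq_max => /andP[Nn Mn].
by rewrite opprD addrACA (le_lt_trans (rnormD _ _))// [ltRHS](splitr e) ltrD ?hN ?hM.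
Qed.

Lemma rcvg_cst x : rcvg (fun=> x) x.
Proof. by move=> e e0; exists 0%N => n _; rewrite subrr rnorm0. Qed.

Lemma rcvgZ (c : R[i]) (u : nat -> V) x : rcvg u x ->
  rcvg (fun n => c *: u n) (c *: x).
Proof.
move=> ux e e0; have c0 : 0 < Normc.normc c + 1 by rewrite ltr_wpDl ?normc_ge0.
have [N hN] := ux _ (divr_gt0 e0 c0); exists N => n /hN.
rewrite -scalerBr rnormZ ltr_pdivlMr// mulrC; apply: le_lt_trans.
by rewrite ler_wpM2r ?rnorm_ge0// lerDl.
Qed.

End Normed.

Lemma rcvg_lip (V W : normedModType R[i]) (f : V -> W) (C : R) (u : nat -> V) x :
  (forall y z, rnorm (f y - f z) <= C * rnorm (y - z)) ->
  rcvg u x -> rcvg (f \o u) (f x).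
Proof.
move=> fC ux e e0.
have C0 : 0 < `|C| + 1 by rewrite ltr_wpDl.
have [N hN] := ux _ (divr_gt0 e0 C0); exists N => n /hN.
rewrite ltr_pdivlMr// mulrC; apply: le_lt_trans; apply: le_trans (fC _ _) _.
by rewrite ler_wpM2r ?rnorm_ge0// (le_trans (ler_norm C))// lerDl.
Qed.

Lemma cvg_rcvg (V : normedModType R[i]) (u : nat -> V) l :
  u @ \oo --> l <-> rcvg u l.
Proof.
split=> [ul e e0|ul].
  have e0' : 0 < ((e)%:C)%C :> R[i] by rewrite ltcR.
  have /cvgrPdist_lt/(_ _ e0') [N _ hN] := ul.
  by exists N => n /hN; rewrite /= ltr_norm_rnorm//= rnorm_dist.
apply/cvgrPdist_lt => e e0.
have re0 : 0 < complex.Re e by case: e e0 => a b; rewrite ltcE /= => /andP[].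
have [N hN] := ul _ re0; exists N => // n /= Nn.
by rewrite ltr_norm_rnorm// rnorm_dist hN.
Qed.

Lemma closure_approx (V : normedModType R[i]) (S : set V) x (e : R) :
  closure S x -> 0 < e -> exists2 y, S y & rnorm (x - y) < e.
Proof.
move=> Sx e0; have e0' : 0 < ((e)%:C)%C :> R[i] by rewrite ltcR.
have [y [Sy xy]] := Sx _ (nbhsx_ballx x _ e0'); exists y => //.
by move: xy; rewrite -ball_normE /= ltr_norm_rnorm.
Qed.

Lemma rcvg_norm_le (V W : normedModType R[i]) (u : nat -> V) (v : nat -> W) x y :
  rcvg u x -> rcvg v y -> (forall n, rnorm (u n) <= rnorm (v n)) ->
  rnorm x <= rnorm y.
Proof.
move=> ux vy uv; apply/ler_addgt0Pr => e e0.
have [N hN] := ux _ (half_gt0 e0); have [M hM] := vy _ (half_gt0 e0).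
have h1 := hN _ (leq_maxl N M); have h2 := hM _ (leq_maxr N M).
have h3 := rnormB (u (maxn N M)) (u (maxn N M) - x); rewrite subKr in h3.
have h4 := rnormD (v (maxn N M) - y) y; rewrite subrK in h4.
by have := uv (maxn N M); lra.
Qed.

Lemma rcauchy_cvg (V : completeNormedModType R[i]) (u : nat -> V) :
  (forall e : R, 0 < e -> exists N, forall n, (N <= n)%N -> rnorm (u n - u N) < e) ->
  exists l, rcvg u l.
Proof.
move=> h.
have cu : cauchy (u @ \oo).
  apply/cauchyP => e e0.
  have re0 : 0 < complex.Re e by case: e e0 => a b; rewrite ltcE /= => /andP[].
  have [N hN] := h _ re0; exists (u N).
  exists N => // n /= Nn; rewrite -ball_normE /= ltr_norm_rnorm// rnorm_dist.
  exact: hN.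
exists (lim (u @ \oo)); apply/cvg_rcvg; exact: cauchy_cvg.
Qed.

Lemma geometric_cvg (V : completeNormedModType R[i]) (u : nat -> V) (C q : R) :
  0 <= q -> q < 1 -> (forall n, rnorm (u n.+1 - u n) <= C * q ^+ n) ->
  exists2 l, rcvg u l & forall n, rnorm (u n - l) <= C * q ^+ n / (1 - q).
Proof.
move=> q0 q1 h; have q1' : 0 < 1 - q by rewrite subr_gt0.
have C0 : 0 <= C by have := h 0%N; rewrite expr0 mulr1; exact: le_trans (rnorm_ge0 _).
(* The factor [1 - q ^+ m] gives the exact partial sum of the geometric series, which lets the
   induction on [m] close. *)
have dist n m : rnorm (u (n + m)%N - u n) <= C * q ^+ n / (1 - q) * (1 - q ^+ m).
  elim: m => [|m ih]; first by rewrite addn0 subrr rnorm0 expr0 subrr mulr0.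
  rewrite addnS (le_trans (rnorm_triangle (u (n + m)%N) _ _))//.
  apply: (le_trans (lerD (h _) ih)).
  rewrite exprD exprS le_eqVlt; apply/orP; left; apply/eqP.
  by field; rewrite gt_eqF.
have dist' n m : (n <= m)%N -> rnorm (u m - u n) <= C * q ^+ n / (1 - q).
  move=> nm; rewrite -(subnKC nm) (le_trans (dist _ _))//.
  rewrite -[leRHS]mulr1 ler_wpM2l//.
    by rewrite divr_ge0 ?mulr_ge0 ?exprn_ge0// ltW.
  by rewrite gerDl oppr_le0 exprn_ge0.
have small e : 0 < e -> exists N, C * q ^+ N / (1 - q) < e.
  move=> e0; move: (q0); rewrite le0r => /orP[/eqP ->|qp].
    by exists 1%N; rewrite expr1 mulr0 mul0r.
  have d0 : 0 < q^-1 - 1 by rewrite subr_gt0 invf_gt1.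
  have [N hN] := exp_unbounded (C / ((1 - q) * e)) d0.
  exists N; rewrite ltr_pdivrMr//.
  move: hN; rewrite (addrC 1 (q^-1 - 1)) subrK exprVn ltr_pdivrMr ?mulr_gt0// mulrC.
  by rewrite ltr_pdivlMr ?exprn_gt0// [e * _]mulrC.
have [l ul] : exists l, rcvg u l.
  apply: rcauchy_cvg => e /small[N hN]; exists N => n Nn.
  by apply: le_lt_trans hN; exact: dist'.
exists l => // n; rewrite leNgt; apply/negP => hn.
move: (hn); rewrite -subr_gt0 => /ul[N hN].
have := hN (maxn N n) (leq_maxl _ _).
have := dist' _ _ (leq_maxr N n).
have := rnorm_triangle (u (maxn N n)) (u n) l.
by rewrite [rnorm (u n - u _)]rnorm_dist; lra.
Qed.

End NormSequences.

(** * Uniform boundedness and C*-algebras *)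

Section Bounded.
Variables (R : realType) (V : completeNormedModType R[i]) (W : preCstarType R).

(* Baire category: since |S x| >= |(S v)^* S x| whenever |S v| <= 1, the set of
   x with |S x| > n is open; if S is unbounded, this set is also dense. *)
Lemma bounded_of_star_bounded (S : V -> W) : linear S ->
  (forall v, exists C : R, forall w, rnorm (star (S v) ** S w) <= C * rnorm w) ->
  exists C : R, forall w, rnorm (S w) <= C * rnorm w.
Proof.
move=> Slin Sb; apply: contrapT => nb.
have SD x y : S (x + y) = S x + S y by have := Slin 1 x y; rewrite !scale1r.
have S0 : S 0 = 0 by apply: (@addrI _ (S 0)); rewrite -SD !addr0.
have SZ c x : S (c *: x) = c *: S x by have := Slin c x 0; rewrite S0 !addr0.
have SB x y : S (x - y) = S x - S y by rewrite -scaleN1r SD SZ scaleN1r.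
have large (K r : R) : 0 <= K -> 0 < r -> exists2 w, rnorm w <= r & K < rnorm (S w).
  move=> K0 r0; apply: contrapT => h; apply: nb; exists (K / r) => w.
  rewrite leNgt; apply/negP => hw; apply: h.
  have w0 : 0 < rnorm w.
    rewrite lt0r rnorm_ge0 andbT; apply: contraTneq hw => /[dup] /rnorm_eq0 -> ->.
    by rewrite mulr0 S0 rnorm0 ltxx.
  have rw0 : 0 <= r / rnorm w by rewrite divr_ge0 ?rnorm_ge0// ltW.
  exists (((r / rnorm w)%:C)%C *: w); first by rewrite rnormZr// divfK ?gt_eqF.
  rewrite SZ rnormZr// mulrAC ltr_pdivlMr// -ltr_pdivrMl// mulrA.
  by rewrite (mulrC r^-1).
have dense (K r : R) x : 0 <= K -> 0 < r ->
    exists2 y, rnorm (y - x) <= r & K < rnorm (S y).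
  move=> K0 r0; have [w wr Kw] := large _ _ K0 r0.
  (* [S (x + w)] and [S (x - w)] differ by [2 S w], so one of them has norm above [K]. *)
  have [?|h1] := ltP K (rnorm (S (x + w))).
    by exists (x + w) => //; rewrite addrAC subrr add0r.
  exists (x - w); first by rewrite addrAC subrr add0r rnormN.
  rewrite ltNge; apply/negP => h2; move: Kw; apply/negP; rewrite -leNgt.
  have e2 : S (x + w) - S (x - w) = ((2%:R : R)%:C)%C *: S w.
    rewrite SD SB opprB (addrC (S x)) -addrA (addrCA (S x)) subrr addr0.
    by rewrite rmorph_nat scaler_nat mulr2n.
  have := rnormB (S (x + w)) (S (x - w)).
  by rewrite e2 rnormZr ?ler0n//; move: h1 h2; lra.
have open (K : R) x : 0 <= K -> K < rnorm (S x) -> exists2 d : R, 0 < d &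
    forall y, rnorm (y - x) <= d -> K < rnorm (S y).
  move=> K0 Kx; have [C hC] := Sb x.
  have x0 : 0 < rnorm (S x) by exact: le_lt_trans Kx.
  have C0 : 0 < `|C| + 1 by rewrite ltr_wpDl.
  (* Chosen so that [(|C| + 1) d] is half of [|S x| (|S x| - K)], the amount by which [|S x|^2]
     exceeds [K |S x|]. *)
  pose d := rnorm (S x) * (rnorm (S x) - K) / (`|C| + 1) / 2.
  have d0 : 0 < d by rewrite !divr_gt0// mulr_gt0// subr_gt0.
  exists d => // y yx.
  have h1 : rnorm (star (S x) ** S (y - x)) <= (`|C| + 1) * d.
    rewrite (le_trans (hC _))// (le_trans (ler_wpM2r (rnorm_ge0 _) (ler_norm C)))//.
    apply: ler_pM => //; first exact: rnorm_ge0.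
    by rewrite lerDl.
  have h2 := rnormM (star (S x)) (S y).
  have h3 := rnormB (star (S x) ** S y) (star (S x) ** S (y - x)).
  move: h3; rewrite -smulBr SB subKr.
  have -> : rnorm (star (S x) ** S x) = rnorm (S x) ^+ 2.
    by apply: complexI; rewrite rmorphXn /= -!rnormE norm_star_smul.
  move=> h3; move: h2.
  rewrite [rnorm (star _)]/rnorm norm_star -/(rnorm (S x)) => h2.
  have h4 : (`|C| + 1) * d = rnorm (S x) * (rnorm (S x) - K) / 2.
    by rewrite /d; field; rewrite gt_eqF.
  rewrite h4 SB in h1; rewrite -(ltr_pM2l x0).
  have xK : 0 < rnorm (S x) - K by rewrite subr_gt0.
  by have := mulr_gt0 x0 xK; nra.
have step (np : nat * (V * R)) : exists q : V * R, 0 < np.2.2 ->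
    [/\ 0 < q.2, q.2 <= np.2.2 / 2, rnorm (q.1 - np.2.1) <= np.2.2 / 2 &
        forall y, rnorm (y - q.1) <= q.2 -> np.1%:R < rnorm (S y)].
  case: np => n [x r] /=; have [r0|] := ltP 0 r; last by move=> _; exists (x, r).
  have [y yx ny] := dense n%:R _ x (ler0n _ _) (half_gt0 r0).
  have [d d0 hd] := open _ y (ler0n _ _) ny.
  exists (y, Num.min d (r / 2)) => _ /=; split=> //.
  - by rewrite lt_min d0 half_gt0.
  - by rewrite ge_min lexx orbT.
  - by move=> z hz; apply: hd; rewrite (le_trans hz)// ge_min lexx.
have [f fP] := choice step.
pose p := fix p n : V * R := if n is m.+1 then f (m, p m) else (0, 1).
have p0 n : 0 < (p n).2.
  by elim: n => [|n ih] //=; have [] := fP (n, p n) ih.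
have pP n := fP (n, p n) (p0 n).
have pr n : (p n).2 <= (2^-1) ^+ n.
  elim: n => [|n ih] //=; rewrite exprS mulrC.
  by have [_ h _ _] := pP n; apply: (le_trans h); rewrite ler_pM2r.
have [|||l pl _] := @geometric_cvg R V (fun n => (p n).1) 2^-1 2^-1.
- by rewrite invr_ge0.
- by rewrite invf_lt1// ltr1n.
- move=> n; have [_ _ h _] := pP n; apply: (le_trans h).
  by rewrite /= mulrC ler_pM2l ?invr_gt0 ?pr.
(* The closed balls are nested: distance of the centres plus the smaller radius is at most the
   larger one. Hence the limit of the centres lies in all of them. *)
have nest n m : rnorm ((p (n + m)%N).1 - (p n).1) + (p (n + m)%N).2 <= (p n).2.
  elim: m => [|m ih]; first by rewrite addn0 subrr rnorm0 add0r.
  rewrite addnS; have [_ h1 h2 _] := pP (n + m)%N.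
  have h3 := rnorm_triangle (p (n + m)%N).1 (p (n + m).+1).1 (p n).1.
  by move: h1 h2 h3 ih; rewrite /=; lra.
have lP n : rnorm (l - (p n).1) <= (p n).2.
  rewrite rnorm_dist; apply: (@rcvg_le _ _ (fun m => (p n).1 - (p (n + m)%N).1)).
    apply: rcvgD; first exact: rcvg_cst.
    move=> e /pl[N hN]; exists N => m Nm.
    by rewrite -opprD rnormN hN// (leq_trans Nm)// leq_addl.
  move=> m; have := nest n m; rewrite rnorm_dist; have := p0 (n + m)%N; lra.
(* On ball number [n + 1] the norm of [S] exceeds [n]; this is applied with an integer [n] above
   [|S l|]. *)
have := truncnS_gt (rnorm (S l)); apply/negP; rewrite -leNgt.
have [_ _ _ h] := pP (Num.truncn (rnorm (S l))).+1.
exact: ltW (h l (lP (Num.truncn (rnorm (S l))).+2)).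
Qed.

End Bounded.

(** * Consequences of the C*-identity, and the Neumann series *)

Section PreCStar.
Variables (R : realType) (B : preCstarType R).
Implicit Types x y z h : B.

Lemma rnorm_star x : rnorm (star x) = rnorm x.
Proof. by rewrite /rnorm norm_star. Qed.

Lemma rnorm_star_smul x : rnorm (star x ** x) = rnorm x ^+ 2.
Proof. by apply: complexI; rewrite rmorphXn /= -!rnormE norm_star_smul. Qed.

Lemma rnorm_smul_star x : rnorm (x ** star x) = rnorm x ^+ 2.
Proof. by have := rnorm_star_smul (star x); rewrite starK rnorm_star. Qed.

Lemma star_smul_eq0 x : star x ** x = 0 -> x = 0.
Proof.
move=> x0; apply: rnorm_eq0; have := rnorm_star_smul x.
by rewrite x0 rnorm0 => /esym/eqP; rewrite expf_eq0 => /eqP.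
Qed.

Lemma rcvg_smulr (u : nat -> B) x y : rcvg u x -> rcvg (fun n => u n ** y) (x ** y).
Proof.
apply: (@rcvg_lip R B B (smul^~ y) (rnorm y)) => a b.
by rewrite -smulBl mulrC rnormM.
Qed.

Lemma rcvg_smull (u : nat -> B) x y : rcvg u x -> rcvg (fun n => y ** u n) (y ** x).
Proof.
apply: (@rcvg_lip R B B (smul y) (rnorm y)) => a b.
by rewrite -smulBr rnormM.
Qed.

Lemma rcvgM (u v : nat -> B) x y : rcvg u x -> rcvg v y ->
  rcvg (fun n => u n ** v n) (x ** y).
Proof.
move=> ux vy e e0.
have x0 : 0 < rnorm x + 1 by rewrite ltr_wpDl ?rnorm_ge0.
have y0 : 0 < rnorm y + 1 by rewrite ltr_wpDl ?rnorm_ge0.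
have [N hN] := ux _ (divr_gt0 (half_gt0 e0) y0).
have [N1 hN1] := ux _ ltr01.
have [M hM] := vy _ (divr_gt0 (half_gt0 e0) x0).
exists (maxn N (maxn N1 M)) => n; rewrite !geq_max => /and3P[/hN h1 /hN1 h2 /hM h3].
have -> : u n ** v n - x ** y = (u n - x) ** y + u n ** (v n - y).
  by rewrite smulBl smulBr [RHS]addrC addrA subrK.
rewrite (le_lt_trans (rnormD _ _))// [ltRHS](splitr e) ltrD//.
  rewrite (le_lt_trans (rnormM _ _))//; rewrite ltr_pdivlMr// in h1.
  by apply: le_lt_trans h1; rewrite ler_wpM2l ?rnorm_ge0// lerDl.
rewrite (le_lt_trans (rnormM _ _))//; rewrite ltr_pdivlMr// in h3.
apply: le_lt_trans h3; rewrite mulrC ler_wpM2l ?rnorm_ge0//.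
have := rnormD (u n - x) x; rewrite subrK; move: (ltW h2); lra.
Qed.

Lemma rcvg_star (u : nat -> B) x : rcvg u x -> rcvg (fun n => star (u n)) (star x).
Proof.
apply: (@rcvg_lip R B B (@star R B) 1) => a b.
by rewrite -starB rnorm_star mul1r.
Qed.

Lemma iter_smulA h n x y : iter n (smul h) x ** y = iter n (smul h) (x ** y).
Proof. by elim: n => //= n ih; rewrite -smulA ih. Qed.

Lemma iter_smul_comm h n : iter n (smul h) h = iter n (smul^~ h) h.
Proof.
elim: n => //= n <-; elim: n => //= n ih.
by rewrite -smulA -ih.
Qed.

Lemma star_iter_smul h n : star h = h -> star (iter n (smul h) h) = iter n (smul h) h.
Proof.
move=> hh; rewrite [in RHS]iter_smul_comm.
by elim: n => //= n ih; rewrite starM hh ih.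
Qed.

(* [iter n (smul h) h] is the power h^(n+1). *)
Lemma rnorm_iter_smul h k : star h = h ->
  rnorm (iter (2 ^ k).-1 (smul h) h) = rnorm h ^+ (2 ^ k).
Proof.
move=> hh; elim: k => [|k ih]; first by rewrite expn0 expr1.
rewrite expnS mulnC exprM -ih -rnorm_star_smul star_iter_smul// iter_smulA.
rewrite -[h ** iter _ _ _]iterS -iterD muln2 -addnn.
by case: (2 ^ k)%N (expn_gt0 2 k) => // n _.
Qed.

End PreCStar.

(** With [w = h + h^2 + ...], [1 + w] is a right inverse of [1 - h]; the equation expresses this
    without a unit, which [B] may lack. *)
Lemma neumann (R : realType) (B : cstarType R) (h : B) :
  rnorm h < 1 -> exists w, w = h + h ** w.
Proof.
move=> h1; pose u n := iter n (fun w => h + h ** w) (0 : B).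
have [|l ul _] := @geometric_cvg R B u (rnorm h) (rnorm h) (rnorm_ge0 h) h1.
  elim=> [|n ih]; first by rewrite /u /= smul0r addr0 subr0 expr0 mulr1.
  have -> : u n.+2 - u n.+1 = h ** (u n.+1 - u n).
    by rewrite /u !iterS opprD addrACA subrr add0r smulBr.
  rewrite (le_trans (rnormM _ _))// exprS mulrCA.
  by rewrite ler_wpM2l ?rnorm_ge0.
exists l; apply: (@rcvg_unique _ _ (fun n => u n.+1)).
  by move=> e /ul[N hN]; exists N => n Nn; apply: hN; exact: leqW.
by apply: rcvgD; [exact: rcvg_cst|exact: rcvg_smull].
Qed.

(** * Topologies given by seminorms *)

Section SeminormTopologyTheory.
Variables (R : realType) (X Y : zmodType) (I K : Type).
Variables (p : I -> X -> \bar R) (pr : I -> X -> R).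
Variables (q : K -> Y -> \bar R) (qr : K -> Y -> R).
Hypothesis pE : forall i x, p i x = (pr i x)%:E.
Hypothesis qE : forall k y, q k y = (qr k y)%:E.
Local Notation TX := (seminorm_topology p).
Local Notation TY := (seminorm_topology q).

Lemma seminorm_ball_open i (x : X) (e : R) : 0 < e ->
  open (seminorm_ball p i x e : set TX).
Proof.
move=> e0; exists [set seminorm_ball p i x e : set TX]; last first.
  by rewrite predeqE => z; split=> [[_ ->]|] // zB; exists (seminorm_ball p i x e).
move=> _ ->; exists [fset (seminorm_ball p i x e : set TX)]%fset.
  by move=> B /=; rewrite inE => /eqP ->; apply/mem_set; exists i, x, e.
rewrite predeqE => z; split=> [h|zB E /=]; first exact: (h _ (fset11 _)).
by rewrite inE => /eqP ->.
Qed.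

Lemma seminorm_open (U : set TX) : (forall i, pr i 0 = 0) ->
  (forall x, U x -> exists i (e : R), 0 < e /\ seminorm_ball p i x e `<=` U) ->
  open U.
Proof.
move=> p0 h; rewrite openE => x /h[i [e [e0 sU]]].
apply: (filterS sU); apply: (open_nbhs_nbhs (conj (seminorm_ball_open i x e0) _)).
by rewrite /seminorm_ball /= subrr pE p0 lte_fin.
Qed.

Lemma continuous_to_seminorm (T : topologicalType) (f : T -> TY) :
  (forall k y (e : R), 0 < e -> open (f @^-1` (seminorm_ball q k y e))) ->
  continuous f.
Proof.
move=> h t A; rewrite (@nbhsE TY) => -[_ [[B sB <-] [C BC Ct] sUBA]].
rewrite nbhs_filterE; apply: filterS sUBA _; apply: (@filterS _ _ _ C).
  by move=> ? ?; exists C.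
have /sB [D sD IDeC] := BC; rewrite -IDeC; apply: filter_bigI => E DE.
have /set_mem[k [y [e [e0 EB]]]] := (sD : {subset D <= seminorm_subbase q}) E DE.
apply: (open_nbhs_nbhs (conj (_ : open (f @^-1` E)) _)).
  by rewrite EB; exact: h.
by move: Ct; rewrite -IDeC => /(_ _ DE).
Qed.

Lemma seminorm_continuous (f : X -> Y) :
  (forall i x, 0 <= pr i x) -> (forall i, pr i 0 = 0) ->
  (forall k y z, qr k (y + z) <= qr k y + qr k z) ->
  (forall x y, f (x - y) = f x - f y) ->
  (forall k, exists i (C : R), forall x, qr k (f x) <= C * pr i x) ->
  continuous (f : TX -> TY).
Proof.
move=> p_ge0 p0 qD fB fb; apply: continuous_to_seminorm => k y e e0.
apply: seminorm_open => // x; rewrite /seminorm_ball /= qE lte_fin => xe.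
have [i [C hC]] := fb k; have C0 : 0 < `|C| + 1 by rewrite ltr_wpDl.
exists i, ((e - qr k (f x - y)) / (`|C| + 1)).
split; first by rewrite divr_gt0// subr_gt0.
move=> z /=; rewrite pE qE !lte_fin ltr_pdivlMr// ltrBrDr => hz.
have -> : f z - y = f (z - x) + (f x - y) by rewrite fB addrA subrK.
apply: (le_lt_trans (qD _ _ _)); apply: le_lt_trans hz; rewrite lerD2r.
rewrite (le_trans (hC _))// mulrC ler_wpM2l// (le_trans (ler_norm C))//.
by rewrite lerDl.
Qed.

End SeminormTopologyTheory.

Section SeminormBound.
Variables (R : realType) (X Y : lmodType R[i]) (I K : Type).
Variables (p : I -> X -> \bar R) (pr : I -> X -> R).
Variables (q : K -> Y -> \bar R) (qr : K -> Y -> R).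
Hypothesis pE : forall i x, p i x = (pr i x)%:E.
Hypothesis qE : forall k y, q k y = (qr k y)%:E.
Hypothesis prD : forall i x y, pr i (x + y) <= pr i x + pr i y.
Hypothesis pr_ge0 : forall i x, 0 <= pr i x.
Hypothesis prZ : forall i (r : R) x, 0 <= r -> pr i (((r)%:C)%C *: x) = r * pr i x.
Hypothesis qrZ : forall k (r : R) y, 0 <= r -> qr k (((r)%:C)%C *: y) = r * qr k y.

Lemma seminorm_nbhs0 (U : set (seminorm_topology p)) : open U -> U 0 ->
  exists (s : seq I) (d : R), 0 < d /\ forall x, \sum_(i <- s) pr i x < d -> U x.
Proof.
move=> [B sB <-] [C BC C0].
have [D sD DC] := sB _ BC.
suff h (l : seq (set (seminorm_topology p))) :
    (forall E, E \in l -> seminorm_subbase p E /\ E 0) ->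
    exists (s : seq I) (d : R), 0 < d /\
      forall x, \sum_(i <- s) pr i x < d -> forall E, E \in l -> E x.
  have [|s [d [d0 sd]]] := h (enum_fset D).
    move=> E DE; split.
      exact: set_mem ((sD : {subset D <= seminorm_subbase p}) E DE).
    by move: C0; rewrite -DC => /(_ _ DE).
  exists s, d; split=> // x /sd xD; exists C => //.
  by suff : C x by []; rewrite -DC => E /xD.
elim: l => [|E l ih] hl; first by exists [::], 1.
have [|s [d [d0 sd]]] := ih.
  by move=> F Fl; apply: hl; rewrite inE Fl orbT.
have [|[i [x [e [e0 EB]]]] E0] := hl E; first by rewrite inE eqxx.
(* The ball is centred at [x]; by the triangle inequality this radius is left around [0]. *)
have d'0 : 0 < e - pr i (- x).
  by move: E0; rewrite EB /seminorm_ball /= add0r pE lte_fin subr_gt0.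
exists (i :: s), (Num.min d (e - pr i (- x))); split.
  by rewrite lt_min d0.
move=> y; rewrite big_cons lt_min => /andP[h1 h2] F; rewrite inE => /orP[/eqP ->|].
  rewrite EB /seminorm_ball /= pE lte_fin (le_lt_trans (prD _ _ _))//.
  rewrite -ltrBrDr (le_lt_trans _ h2)// lerDl.
  by apply: sumr_ge0 => j _; exact: pr_ge0.
by apply: sd; apply: le_lt_trans h1; rewrite lerDr.
Qed.

Lemma seminorm_bound (f : X -> Y) :
  continuous (f : seminorm_topology p -> seminorm_topology q) ->
  (forall c x, f (c *: x) = c *: f x) ->
  forall k, exists (s : seq I) (C : R),
    forall x, qr k (f x) <= C * \sum_(i <- s) pr i x.
Proof.
move=> fc fZ k.
have f0 : f 0 = 0 by have := fZ 0 0; rewrite !scale0r.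
have q0 : qr k 0 = 0.
  by have := @qrZ k 0 0 (lexx 0); rewrite scaler0 mul0r.
move/continuousP : fc => /(_ _ (seminorm_ball_open q k 0 ltr01)) fo.
have [|s [d [d0 sd]]] := seminorm_nbhs0 fo.
  by rewrite /= /seminorm_ball /= f0 subrr qE q0 lte_fin.
exists s, d^-1 => x; apply/ler_addgt0Pr => e e0.
set S := \sum_(i <- s) _.
have S0 : 0 <= S by apply: sumr_ge0 => i _; exact: pr_ge0.
have Sde : 0 < S + d * e by rewrite ltr_wpDl// mulr_gt0.
(* The summand [d * e] keeps the denominator positive when [S = 0] and makes [t * S] strictly less
   than [d]; then [t^-1] is [S / d + e]. *)
pose t := d / (S + d * e).
have t0 : 0 < t by rewrite divr_gt0.
have := sd (((t)%:C)%C *: x).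
rewrite /= /seminorm_ball /= subr0 qE lte_fin fZ (qrZ _ _ (ltW t0)).
have -> : \sum_(i <- s) pr i (((t)%:C)%C *: x) = t * S.
  by rewrite mulr_sumr; apply: eq_bigr => i _; rewrite (prZ _ _ (ltW t0)).
move=> /(_ _)/ltW h; rewrite (le_trans (_ : _ <= t^-1)) //.
  rewrite -(ler_pM2l t0) divff ?gt_eqF// h//.
  rewrite /t mulrAC ltr_pdivrMr// ltr_pM2l// ltrDl; exact: mulr_gt0.
by rewrite invf_div mulrDl [d * e / d]mulrAC divff ?gt_eqF// mul1r mulrC.
Qed.

End SeminormBound.

(** * The support algebra is the Pedersen ideal *)

Lemma dense_approx (R : realType) (B : normedModType R[i]) (I : set B) x (e : R) :
  dense I -> 0 < e -> exists2 y, I y & rnorm (x - y) < e.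
Proof.
move=> Id e0; apply: closure_approx e0 => U Ux.
have [|y [By Iy]] := Id (interior U) _ (open_interior _); first by exists x.
by exists y; split=> //; exact: interior_subset By.
Qed.

Lemma approx_dense (R : realType) (B : normedModType R[i]) (I : set B) :
  (forall x (e : R), 0 < e -> exists2 y, I y & rnorm (x - y) < e) -> dense I.
Proof.
move=> h O [x Ox] Oo; have : nbhs x O by apply: open_nbhs_nbhs.
move=> /nbhs_ballP[e /= e0 xeO].
have re0 : 0 < complex.Re e by case: e e0 {xeO} => a b; rewrite ltcE /= => /andP[].
have [y Iy xy] := h x _ re0; exists y; split=> //.
by apply: xeO; rewrite -ball_normE /= ltr_norm_rnorm.
Qed.

Section SupportAlgebraTheory.
Variables (R : realType) (A : starAlgType R) (L : lc_sigma_cstar A).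
Local Notation e := (lc_seq L).
Local Notation J := (A00 e).
Local Notation one := (lc_one L).
Local Notation pi n := (lproj L n).
Local Notation ideal n :=
  (lspan [set y | exists b c, y = b ** (e n ** e n) ** c]).
Implicit Types a b c x y : A.

Lemma infnorm_leP a (M : R) :
  (infnorm L a <= M%:E)%E <-> forall n, rnorm (pi n a) <= M.
Proof.
split=> [aM n|h].
  by rewrite -lee_fin (le_trans _ aM)//; apply: ereal_sup_ubound; exists n.
by apply: ge_ereal_sup => _ [n _ <-]; rewrite lee_fin.
Qed.

Lemma rnorm_Ab (x : Ab L) : (rnorm x)%:E = infnorm L (Ab_val x).
Proof. exact: Ab_normE. Qed.

Lemma rnorm_A0 (x : A0 L) : (rnorm x)%:E = infnorm L (A0_val x).
Proof. exact: Ab_normE. Qed.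

Lemma lproj_le_A0 n (x : A0 L) : rnorm (pi n (A0_val x)) <= rnorm x.
Proof. by rewrite -lee_fin rnorm_A0; apply: ereal_sup_ubound; exists n. Qed.

Lemma lc_star n : star (e n) = e n.
Proof. exact: positive_star (mb_pos e n). Qed.

Lemma lc_one_l a : one ** a = a. Proof. by have [] := lc_oneP L a. Qed.
Lemma lc_one_r a : a ** one = a. Proof. by have [] := lc_oneP L a. Qed.

Lemma lc_eS n : e n ** e n.+1 = e n.
Proof. exact: lc_canonical_r. Qed.

Lemma lc_Se n : e n.+1 ** e n = e n.
Proof. exact: lc_canonical. Qed.

Lemma A00_er n b : J (b ** e n).
Proof. by rewrite -[e n]lc_one_r; apply/A00_mull/A00_e. Qed.

Lemma A00_seq n : J (e n).
Proof. by rewrite -[e n]lc_one_l; exact: A00_er. Qed.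

(** The adjoint of [lc_upper], where [e n] multiplies from the left. *)
Lemma lnorm_le_er n a : (infnorm L (a ** e n) <= lnorm L n a)%E.
Proof.
have := lc_upper L n (star a).
rewrite -infnorm_star starM starK lc_star /lnorm lprojS.
by rewrite (rnorm_star (pi n a)).
Qed.

Lemma A0_inj : injective (@A0_val R A L).
Proof. by move=> x y xy; apply: subalg_inj; apply: subalg_inj. Qed.

Definition A00_to_A0 x (Jx : J x) : A0 L :=
  @subalg_in _ _ (closure_subalg (A00_subalg L)) (to_Ab (A00_bounded Jx))
    (subset_closure Jx).

Lemma A0_approx (x : A0 L) (d : R) : 0 < d ->
  exists2 y : A0 L, J (A0_val y) & rnorm (x - y) < d.
Proof.
move=> d0; have d0' : 0 < ((d)%:C)%C :> R[i] by rewrite ltcR.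
have [y Jy xy] := (closure_normP _ _).1 (subalg_valS x) _ d0'.
by exists (A00_to_A0 Jy) => //; move: xy; rewrite ltr_norm_rnorm.
Qed.

Lemma closure_mull (a : Ab L) (x : A0 L) :
  closure (A00_subalg L : set (Ab L)) (a ** closure_val x).
Proof.
apply/closure_normP => d d0.
have rd0 : 0 < complex.Re d by case: d d0 => u v; rewrite ltcE /= => /andP[].
have a0 : 0 < rnorm a + 1 by rewrite ltr_wpDl// rnorm_ge0.
have [y Jy xy] := A0_approx x (divr_gt0 rd0 a0).
exists (a ** closure_val y); first exact: A00_mull.
rewrite ltr_norm_rnorm// -smulBr (le_lt_trans (rnormM _ _))//.
rewrite ltr_pdivlMr// in xy; apply: le_lt_trans xy; rewrite mulrC.
by rewrite ler_wpM2l ?rnorm_ge0// lerDl.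
Qed.

Lemma closure_mulr (a : Ab L) (x : A0 L) :
  closure (A00_subalg L : set (Ab L)) (closure_val x ** a).
Proof.
rewrite -[_ ** _]starK starM; apply: closure_subalgS.
have -> : star (closure_val x) = closure_val (star x : A0 L) by [].
exact: closure_mull.
Qed.

Definition A00_set : set (A0 L) := [set x | J (A0_val x)].

Lemma A00_ideal : two_sided_ideal A00_set.
Proof.
split; rewrite /A00_set /=.
- by exists 0%N; exact: lspan0.
- by move=> x y; exact: A00_add.
- by move=> k x [n xn]; exists n; exact: lspanZ.
- by move=> x b Jx; split; [exact: A00_mull|exact: A00_mulr].
Qed.

Lemma A00_dense : dense A00_set.
Proof. by apply: approx_dense => x d; exact: A0_approx. Qed.

Lemma A00_minimal (I : set (A0 L)) :
  two_sided_ideal I -> dense I -> A00_set `<=` I.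
Proof.
move=> [I0 ID IZ IM] Id.
(* If y in I is close to e_(n+1), with h = e_(n+1) - y, then e_n y = e_n (1 - h)
   and 1 - h has inverse 1 + w with w in A_0, so e_n = e_n y (1 + w) is in I. *)
have IE n : I (A00_to_A0 (A00_seq n)).
  set E := A00_to_A0 _; pose E' := A00_to_A0 (A00_seq n.+1).
  have [y Iy Ey] := dense_approx E' Id ltr01.
  have [w wE] := neumann Ey.
  have EE' : E ** E' = E by apply: A0_inj; exact: lc_eS.
  have -> : E = E ** y + E ** y ** w.
    have -> : E ** y = E - E ** (E' - y).
      by rewrite smulBr EE' subKr.
    rewrite smulBl -smulA -smulBr.
    have {1}-> : w = E' - y + (E' - y) ** w by [].
    by rewrite addrK subrK.
  by apply: ID; [case: (IM y E Iy)|case: (IM y E Iy) => Ey' _; case: (IM _ w Ey')].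
(* Induction on [lspan] takes place in [A] while [I] lives in A_0, so the claim is made for a
   preimage of [x]; [A0_inj] brings it back. *)
suff h x : J x -> exists2 x0, A0_val x0 = x & I x0.
  by move=> x /h[x0 /A0_inj <-].
move=> [n]; move: x; apply: lspan_ind.
- by exists 0.
- move=> x y [x0 <- Ix] [y0 <- Iy]; exists (x0 + y0) => //; exact: ID.
- move=> k x [x0 <- Ix]; exists (k *: x0) => //; exact: IZ.
- move=> _ [b [c ->]].
  (* [I] absorbs only elements of A_0, and [b], [c] are arbitrary in [A]: hence [b e_n^2 c] is
     regrouped as [(b e_(n+1)) e_n (e_n c)]. *)
  exists (A00_to_A0 (A00_er n.+1 b) ** A00_to_A0 (A00_seq n) **
    A00_to_A0 (A00_e L n c)).
    rewrite -[LHS]/(b ** e n.+1 ** e n ** (e n ** c)).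
    by rewrite -(smulA b) lc_Se !smulA.
  have [h _] := IM _ (A00_to_A0 (A00_er n.+1 b)) (IE n).
  by have [] := IM _ (A00_to_A0 (A00_e L n c)) h.
Qed.

Definition A00_pedersen : pedersen (A0 L) :=
  Pedersen (And3 A00_ideal A00_dense A00_minimal).

Lemma lspan_mull n a x :
  ideal n x ->
  ideal n (a ** x).
Proof.
move: x; apply: lspan_ind.
- by rewrite smul0r; exact: lspan0.
- by move=> y z ? ?; rewrite smulDr; exact: lspanD.
- by move=> k y ?; rewrite smulZr; exact: lspanZ.
- move=> _ [b [c ->]]; apply: lspan_sub; exists (a ** b), c.
  by rewrite !smulA.
Qed.

Lemma lproj_iter n k a x :
  rnorm (pi n (iter k (smul a) x)) <= rnorm (pi n a) ^+ k * rnorm (pi n x).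
Proof.
elim: k => [|k ih] /=; first by rewrite expr0 mul1r.
rewrite lprojM (le_trans (rnormM _ _))// exprS -mulrA.
by rewrite ler_wpM2l// rnorm_ge0.
Qed.

(* On the ideal generated by e_n the homomorphism pi_n is isometric: for h
   self-adjoint in the ideal, |h|^(2^k) = |h^(2^k)| is at most a constant times
   |pi_n h|^(2^k - 1). *)
Lemma lspan_iter n a x : ideal n x ->
  exists C : R, forall k,
    (infnorm L (iter k (smul a) x) <= (C * rnorm (pi n a) ^+ k)%:E)%E.
Proof.
move: x; apply: lspan_ind.
- exists 0 => k; rewrite mul0r; apply/infnorm_leP => m.
  by rewrite (le_trans (lproj_iter _ _ _ _))// lproj0 rnorm0 mulr0.
- move=> x y [C hC] [D hD]; exists (C + D) => k.
  have -> : iter k (smul a) (x + y) = iter k (smul a) x + iter k (smul a) y.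
    by elim: k => //= k ->; rewrite smulDr.
  by rewrite (le_trans (infnormD _ _ _))// mulrDl EFinD leeD.
- move=> z x [C hC]; exists (Normc.normc z * C) => k.
  have -> : iter k (smul a) (z *: x) = z *: iter k (smul a) x.
    by elim: k => //= k ->; rewrite smulZr.
  have /infnorm_leP h := hC k; apply/infnorm_leP => m.
  by rewrite lprojZ rnormZ -mulrA ler_wpM2l// normc_ge0.
(* One factor [e n] goes to each side, [(a^k b e_n) (e_n c)], and [lnorm_le_er] and [lc_upper] bound
   both by their norms under pi_n. *)
- move=> _ [b [c ->]]; exists (rnorm (pi n b) * rnorm (pi n c)) => k.
  have -> : iter k (smul a) (b ** (e n ** e n) ** c) =
      iter k (smul a) b ** e n ** (e n ** c).
    rewrite smulA -(smulA (b ** e n)).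
    by elim: k => //= k ->; rewrite !smulA.
  have /infnorm_leP h1 : (infnorm L (iter k (smul a) b ** e n) <=
      (rnorm (pi n a) ^+ k * rnorm (pi n b))%:E)%E.
    by rewrite (le_trans (lnorm_le_er _ _))// lee_fin lproj_iter.
  have /infnorm_leP h2 : (infnorm L (e n ** c) <= (rnorm (pi n c))%:E)%E.
    exact: lc_upper.
  apply/infnorm_leP => m; rewrite lprojM (le_trans (rnormM _ _))//.
  by rewrite [leRHS]mulrC mulrA ler_pM ?rnorm_ge0 ?h1 ?h2.
Qed.

(** The power bound is applied to [star x ** x], and the C*-identity in A_0 and in the n-th level
    takes the square root. *)
Lemma lspan_le_lproj n x :
  ideal n x ->
  (infnorm L x <= (rnorm (pi n x))%:E)%E.
Proof.
move=> xn; have Jx : J x by exists n.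
pose h := A00_to_A0 (A00_mull (star x) Jx).
have hn := lspan_mull (star x) xn.
have hh : star h = h.
  by apply: A0_inj; rewrite /= -[LHS]/(star (star x ** x)) starM starK.
have hle : rnorm h <= rnorm (pi n (A0_val h)).
  have [C hC] := lspan_iter (star x ** x) hn.
  apply: (@le_of_pow2_le _ _ _ C) => [||k]; rewrite ?rnorm_ge0//.
  rewrite -rnorm_iter_smul// -lee_fin rnorm_A0.
  apply: le_trans (hC _).
  suff -> : A0_val (iter (2 ^ k).-1 (smul h) h) =
    iter (2 ^ k).-1 (smul (star x ** x)) (star x ** x) by [].
  by elim: (2 ^ k).-1 => //= m <-.
pose y := A00_to_A0 Jx.
rewrite -[x]/(A0_val y) -rnorm_A0 lee_fin -ler_sqr ?nnegrE ?rnorm_ge0//.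
rewrite -!rnorm_star_smul -lprojS -lprojM; exact: hle.
Qed.

(** The adjoint of [lc_lower], with test elements [star (e n ** b)]. Since [e_n e_(n+1) = e_n], they
    absorb [e n.+1] on the right; this places them in A_00 and in the left ideal generated by
    [e n.+1]. *)
Lemma lproj_le_sup n a (C : R) :
  (forall b : A0 L, rnorm b <= 1 -> A0_val b ** e n.+1 = A0_val b ->
     (infnorm L (a ** A0_val b) <= C%:E)%E) ->
  rnorm (pi n a) <= C.
Proof.
move=> h; rewrite -lee_fin.
have := lc_lower L n (star a); rewrite /lnorm lprojS (rnorm_star (pi n a)) => h1.
apply: (le_trans h1); apply: ge_ereal_sup => _ [b /= eb <-].
rewrite -infnorm_star starM starK.
pose y : A0 L := star (A00_to_A0 (A00_e L n b)).
apply: (h y).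
  by rewrite rnorm_star -lee_fin rnorm_A0.
rewrite -[A0_val y]/(star (e n ** b)) starM lc_star.
by rewrite -smulA lc_eS.
Qed.

End SupportAlgebraTheory.

(** * Multipliers of the support algebra *)

Section NondegenerateMultipliers.
Variables (R : realType) (J : starAlgType R).
Hypothesis J_nd : forall v : J, star v ** v = 0 -> v = 0.
Implicit Types (m : multiplier J) (x y z u v : J).

Lemma smul_lcancel u v : (forall z, z ** u = z ** v) -> u = v.
Proof.
move=> h; apply/eqP; rewrite -subr_eq0; apply/eqP/J_nd.
by rewrite smulBr h subrr.
Qed.

Lemma smul_rcancel u v : (forall z, u ** z = v ** z) -> u = v.
Proof.
move=> h; rewrite -[u]starK -[v]starK; congr star; apply: smul_lcancel => z.
by rewrite -[z]starK -!starM h.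
Qed.

(** Neither map of a double multiplier is assumed linear or a module map. Multiplying by an
    arbitrary [z] exchanges the two maps, after which the identity is plain algebra, and [z]
    cancels. *)
Lemma mul_lM m x y : mul_l m (x ** y) = mul_l m x ** y.
Proof. by apply: smul_lcancel => z; rewrite multiplierP !smulA multiplierP. Qed.

Lemma mul_rM m x y : mul_r m (x ** y) = x ** mul_r m y.
Proof.
by apply: smul_rcancel => z; rewrite -multiplierP -!smulA multiplierP.
Qed.

Lemma mul_l_linear m : linear (mul_l m).
Proof.
move=> k x y; apply: smul_lcancel => z.
by rewrite smulDr smulZr !multiplierP smulDr smulZr.
Qed.

Lemma mul_l_inj m n : mul_l m = mul_l n -> m = n.
Proof.
move=> mn; apply: multiplier_eq => //; apply/funext => x.
by apply: smul_rcancel => z; rewrite -!multiplierP mn.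
Qed.

End NondegenerateMultipliers.

Lemma linear_add (R : realType) (V W : lmodType R[i]) (f : V -> W) :
  linear f -> forall x y, f (x + y) = f x + f y.
Proof. by move=> h x y; have := h 1 x y; rewrite !scale1r. Qed.

Lemma linear_zero (R : realType) (V W : lmodType R[i]) (f : V -> W) :
  linear f -> f 0 = 0.
Proof. by move=> h; apply: (@addrI _ (f 0)); rewrite -linear_add// !addr0. Qed.

Lemma linear_sub (R : realType) (V W : lmodType R[i]) (f : V -> W) :
  linear f -> forall x y, f (x - y) = f x - f y.
Proof. by move=> h x y; rewrite addrC -scaleN1r h scaleN1r addrC. Qed.

Lemma linear_scale (R : realType) (V W : lmodType R[i]) (f : V -> W) :
  linear f -> forall k x, f (k *: x) = k *: f x.
Proof. by move=> h k x; have := h k x 0; rewrite (linear_zero h) !addr0. Qed.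

Lemma inj_surj_bij (T U : Type) (f : T -> U) :
  injective f -> (forall y, exists x, f x = y) -> bijective f.
Proof.
move=> fi /choice[g gK]; exists g => // x; exact/fi/gK.
Qed.

Lemma pedersen_nd (R : realType) (B : cstarType R) (K : pedersen B)
  (v : pedersen_alg K) : star v ** v = 0 -> v = 0.
Proof.
move=> v0; apply: subalg_inj; apply: star_smul_eq0.
exact: (congr1 (@pedersen_val R B K) v0).
Qed.

(** For fixed [v], [star (S v) ** S w = T (star (S v)) ** w] is bounded in [w]. *)
Lemma multiplier_l_bounded (R : realType) (B : cstarType R) (m : multiplier B) :
  exists C : R, forall w, rnorm (mul_l m w) <= C * rnorm w.
Proof.
apply: bounded_of_star_bounded.
  by apply: mul_l_linear => v; exact: star_smul_eq0.
move=> v; exists (rnorm (mul_r m (star (mul_l m v)))) => w.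
by rewrite multiplierP rnormM.
Qed.

Section Multipliers.
Variables (R : realType) (A : starAlgType R) (L : lc_sigma_cstar A).
Local Notation e := (lc_seq L).
Local Notation J := (A00 e).
Local Notation one := (lc_one L).
Local Notation pi n := (lproj L n).
Local Notation K := (A00_pedersen L).
Implicit Types a b c : A.

Definition K_val (x : pedersen_alg K) : A := A0_val (pedersen_val x).

Definition K_in a (Ja : J a) : pedersen_alg K :=
  @subalg_in _ _ (pedersen_subalg K) (A00_to_A0 Ja) Ja.

Lemma K_valP (x : pedersen_alg K) : J (K_val x).
Proof. exact: (@subalg_valS _ _ (pedersen_subalg K) x). Qed.

Lemma K_inj : injective K_val.
Proof. by move=> x y /A0_inj xy; apply: subalg_inj. Qed.

(** A sequence is Cauchy for the initial uniformity once all its images under the maps [A00_mul i]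
    converge; completeness then gives one element of [A] whose images are all these limits. *)
Lemma A00_seq_limit (u : nat -> A) :
  (forall i, exists l : Ab L, rcvg (fun n => @A00_mul _ _ _ e i (u n)) l) ->
  exists a, forall i, rcvg (fun n => @A00_mul _ _ _ e i (u n)) (A00_mul i a).
Proof.
move=> h.
have uc : @cauchy (A00_topology e) (u @ \oo).
  move=> E [D [W WD <-] DE]; apply: (filterS DE).
  apply: filter_bigI => p _; case: p => [[i V] pV] /=.
  have [V' V'ent V'V] := asboolW pV.
  have [l /cvg_rcvg il] := h i.
  have /cvg_cauchy/(_ V' V'ent)[[P Q] /= [FP FQ] PQV] :
    cvg ((fun n => @A00_mul _ _ _ e i (u n)) @ \oo) by apply/cvg_ex; exists l.
  exists (@A00_mul _ _ _ e i @^-1` P, @A00_mul _ _ _ e i @^-1` Q) => //=.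
  by move=> -[a b] [/= Pa Qb]; apply: V'V; exact: (PQV (A00_mul i a, A00_mul i b)).
have [a ua] := @lc_complete _ _ L _ _ uc.
exists a => i; apply/cvg_rcvg.
exact: (@sup_initial_cvg A (Ab L) _ (@A00_mul R A L e) (u @ \oo) a _ ua i).
Qed.

Lemma lc_seq_limit i :
  rcvg (fun n => @A00_mul _ _ _ e i (e n)) (A00_mul i one).
Proof.
apply/cvg_rcvg.
exact: (@sup_initial_cvg A (Ab L) _ (@A00_mul R A L e)
  ((fun n => e n : A) @ \oo) one _ (@lc_cvg _ _ L) i).
Qed.

Definition K_seq n : pedersen_alg K := K_in (A00_seq L n).

Lemma K_seq_r (x : pedersen_alg K) :
  rcvg (fun n => pedersen_val (x ** K_seq n)) (pedersen_val x).
Proof.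
move=> d /(lc_seq_limit (inl (exist _ _ (K_valP x))))[N hN]; exists N => n /hN.
suff -> : A00_mul (inl (exist J _ (K_valP x))) one = closure_val (pedersen_val x) by [].
by apply: subalg_inj; rewrite /= lc_one_r.
Qed.

Lemma K_seq_l (x : pedersen_alg K) :
  rcvg (fun n => pedersen_val (K_seq n ** x)) (pedersen_val x).
Proof.
move=> d /(lc_seq_limit (inr (exist _ _ (K_valP x))))[N hN]; exists N => n /hN.
suff -> : A00_mul (inr (exist J _ (K_valP x))) one = closure_val (pedersen_val x) by [].
by apply: subalg_inj; rewrite /= lc_one_l.
Qed.

Definition K_mult a : multiplier (pedersen_alg K).
Proof.
refine (@Multiplier _ _ (fun x => K_in (A00_mull a (K_valP x)))
  (fun x => K_in (A00_mulr a (K_valP x))) _).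
by move=> x y; apply: K_inj; exact: smulA.
Defined.

Lemma K_multl a x : K_val (mul_l (K_mult a) x) = a ** K_val x.
Proof. by []. Qed.

Lemma K_multr a x : K_val (mul_r (K_mult a) x) = K_val x ** a.
Proof. by []. Qed.

Lemma K_mult_inj : injective K_mult.
Proof.
move=> a b ab; apply/eqP; rewrite -subr_eq0; apply/eqP.
apply: (@lproj_eq0 _ _ L) => n; apply: rnorm_eq0; apply/eqP.
rewrite eq_le rnorm_ge0 andbT; apply: lproj_le_sup => y _ ye.
have Jy : J (A0_val y) by rewrite -ye; exact: A00_er.
have := congr1 (fun m => K_val (mul_l m (K_in Jy))) ab.
rewrite !K_multl /K_val /= => h; rewrite smulBl h subrr.
by apply/infnorm_leP => k; rewrite lproj0 rnorm0.
Qed.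

(* [mul_l m] is bounded on { y | y e_k = y } by the uniform boundedness
   principle, applied to y |-> m (y e_k) on the whole of A_0. *)
Lemma K_mult_bounded (m : multiplier (pedersen_alg K)) k : exists C : R,
  forall y : pedersen_alg K, K_val y ** e k = K_val y ->
    rnorm (pedersen_val (mul_l m y)) <= C * rnorm (pedersen_val y).
Proof.
pose f (y : A0 L) := K_in (A00_er L k (A0_val y)).
pose S y := pedersen_val (mul_l m (f y)).
have Slin : linear S.
  move=> c y z; rewrite /S; have -> : f (c *: y + z) = c *: f y + f z.
    apply: K_inj; rewrite -[LHS]/((c *: A0_val y + A0_val z) ** e k).
    by rewrite smulDl smulZl.
  by rewrite mul_l_linear//; exact: pedersen_nd.
have [|C hC] := @bounded_of_star_bounded _ (A0 L) (A0 L) S Slin.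
  move=> v; exists (rnorm (pedersen_val (mul_r m (star (mul_l m (f v))))) *
    rnorm (pedersen_val (K_seq k))) => w.
  have -> : star (S v) ** S w =
      pedersen_val (mul_r m (star (mul_l m (f v))) ** f w).
    by rewrite -multiplierP.
  rewrite -mulrA (le_trans (rnormM _ (pedersen_val (f w))))//.
  rewrite ler_wpM2l ?rnorm_ge0// mulrC.
  have -> : pedersen_val (f w) = w ** pedersen_val (K_seq k) by apply: A0_inj.
  exact: rnormM.
exists C => y ye; have {1}-> : y = f (pedersen_val y).
  by apply: K_inj; rewrite -[RHS]/(K_val y ** e k) ye.
exact: hC.
Qed.

(** On a generator [x = y z] with [y = b e_k], [z = e_k c], one has [m(e_n) x = m(e_n y) z].
    Although [m] may be discontinuous on all of A_00, [e_n y - y] stays in the set fixed by [e k.+1]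
    on the right, where [m] is bounded. *)
Lemma K_multl_cvg (m : multiplier (pedersen_alg K)) x :
  rcvg (fun n => pedersen_val (mul_l m (K_seq n) ** x)) (pedersen_val (mul_l m x)).
Proof.
have nd := @pedersen_nd _ _ K.
suff h a : J a -> exists2 y, K_val y = a &
    rcvg (fun n => pedersen_val (mul_l m (K_seq n) ** y)) (pedersen_val (mul_l m y)).
  by have [y /K_inj ->] := h _ (K_valP x).
move=> [k]; move: a; apply: lspan_ind.
- exists 0 => //; rewrite (linear_zero (mul_l_linear nd m)).
  by under eq_fun do rewrite smul0r; exact: rcvg_cst.
- move=> _ _ [y <- hy] [z <- hz]; exists (y + z) => //.
  rewrite (linear_add (mul_l_linear nd m)).
  by under eq_fun do rewrite smulDr; exact: rcvgD.
- move=> c _ [y <- hy]; exists (c *: y) => //.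
  rewrite (linear_scale (mul_l_linear nd m)).
  by under eq_fun do rewrite smulZr; exact: rcvgZ.
- move=> _ [b [c ->]].
  pose y := K_in (A00_er L k b); pose z := K_in (A00_e L k c).
  exists (y ** z).
    by rewrite -[LHS]/(b ** e k ** (e k ** c)) !smulA.
  have [C hC] := K_mult_bounded m k.+1.
  have ye : K_val y ** e k.+1 = K_val y.
    by rewrite -[K_val y]/(b ** e k) -smulA lc_eS.
  rewrite mul_lM//; under eq_fun do rewrite -(mul_lM nd) smulA (mul_lM nd).
  apply: (@rcvg_smulr _ _ (fun n => pedersen_val (mul_l m (K_seq n ** y)))
    (pedersen_val (mul_l m y)) (pedersen_val z)).
  move=> d d0; have C0 : 0 < `|C| + 1 by rewrite ltr_wpDl.
  have [N hN] := K_seq_l y (divr_gt0 d0 C0); exists N => n /hN.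
  rewrite ltr_pdivlMr// mulrC; apply: le_lt_trans.
  rewrite -[X in rnorm X]/(pedersen_val (mul_l m (K_seq n ** y) - mul_l m y)).
  rewrite -(linear_sub (mul_l_linear nd m)).
  have -> : pedersen_val (K_seq n ** y) - pedersen_val y =
    pedersen_val (K_seq n ** y - y) by [].
  apply: le_trans (hC _ _) _.
    rewrite -[K_val _]/(e n ** K_val y - K_val y).
    by rewrite smulBl -smulA ye.
  by rewrite ler_wpM2r ?rnorm_ge0// (le_trans (ler_norm C))// lerDl.
Qed.

(** For a double multiplier [(S, T)] both families of maps converge along [S(e_n)]:
    [x S(e_n) = T(x) e_n] tends to [T(x)], and [S(e_n) x] tends to [S(x)] by [K_multl_cvg]. *)
Lemma K_mult_surj (m : multiplier (pedersen_alg K)) : exists a, K_mult a = m.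
Proof.
have nd := @pedersen_nd _ _ K.
have lim i : exists l : Ab L,
    rcvg (fun n => @A00_mul _ _ _ e i (K_val (mul_l m (K_seq n)))) l.
  case: i => -[x Jx].
    exists (closure_val (pedersen_val (mul_r m (K_in Jx)))).
    move=> d /(K_seq_r (mul_r m (K_in Jx)))[N hN]; exists N => n /hN.
    by rewrite -multiplierP.
  exists (closure_val (pedersen_val (mul_l m (K_in Jx)))).
  by move=> d /(K_multl_cvg m (K_in Jx)).
have [a ha] := A00_seq_limit lim; exists a; apply: (mul_l_inj nd).
apply/funext => x; apply: K_inj; rewrite K_multl.
have /rcvg_unique := ha (inr (exist _ _ (K_valP x))).
move=> /(_ (closure_val (pedersen_val (mul_l m x)))) h.
apply: (congr1 (@Ab_val _ _ L) (h _)).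
by move=> d /(K_multl_cvg m x).
Qed.

Lemma K_mult_iso : star_iso K_mult.
Proof.
split; last exact: inj_surj_bij K_mult_inj K_mult_surj.
split.
- move=> k a b; apply: multiplier_eq; apply/funext => x; apply: K_inj.
    by rewrite K_multl smulDl smulZl.
  by rewrite K_multr smulDr smulZr.
- move=> a b; apply: multiplier_eq; apply/funext => x; apply: K_inj.
    by rewrite K_multl -smulA.
  by rewrite K_multr smulA.
- move=> a; apply: multiplier_eq; apply/funext => x; apply: K_inj.
    by rewrite K_multl -[RHS]/(star (star (K_val x) ** a)) starM starK.
  by rewrite K_multr -[RHS]/(star (a ** star (K_val x))) starM starK.
Qed.

End Multipliers.

(** * The projective topology and the bounded part *)

Section ProjectiveTopology.
Variables (R : realType) (A : starAlgType R) (L : lc_sigma_cstar A).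
Local Notation e := (lc_seq L).
Local Notation J := (A00 e).
Local Notation pi n := (lproj L n).
Local Notation K := (A00_pedersen L).

(** The element of K(A_0) lies in the ideal of some [e n], and so does [a b k]; there pi_n controls
    the norm. *)
Lemma restricted_norm_le (i : pedersen_pos K) : exists n, forall a,
  (restricted_norm i (K_mult L a) <= (rnorm (pi n a))%:E)%E.
Proof.
case: i => k kpos; have [n kn] := K_valP k; exists n => a.
apply: ge_ereal_sup => _ [x [xk x1] <-].
rewrite rnorm_A0; apply/infnorm_leP => m.
rewrite -[A0_val _]/(a ** K_val x); apply/ler_addgt0Pr => d d0.
(* [a] need not be bounded, so the closure is approximated at each level [m] separately, with a
   tolerance depending on [pi m a]. *)
have C0 : 0 < rnorm (pi n a) + rnorm (pi m a) + 1.
  by rewrite ltr_wpDl// addr_ge0 ?rnorm_ge0.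
have [_ [b _ <-] xb] := closure_approx xk (divr_gt0 d0 C0).
set t := d / _ in xb; set y : A0 L := b ** _ in xb.
have -> : a ** K_val x = a ** A0_val y + a ** (A0_val (pedersen_val x - y)).
  by rewrite -[A0_val (_ - _)]/(K_val x - A0_val y) -smulDr addrC subrK.
rewrite lprojD (le_trans (rnormD _ _))//.
have h1 : rnorm (pi m (a ** A0_val y)) <= rnorm (pi n a) * (1 + t).
  have /lspan_le_lproj/infnorm_leP h := lspan_mull a (lspan_mull (A0_val b) kn).
  apply: (le_trans (h m)); rewrite lprojM (le_trans (rnormM _ _))//.
  rewrite ler_wpM2l ?rnorm_ge0// (le_trans (lproj_le_A0 _ y))//.
  have := rnormB (pedersen_val x) (pedersen_val x - y); rewrite subKr.
  by move: (ltW xb) x1; rewrite /=; lra.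
have h2 : rnorm (pi m (a ** A0_val (pedersen_val x - y))) <= rnorm (pi m a) * t.
  rewrite lprojM (le_trans (rnormM _ _))// ler_wpM2l ?rnorm_ge0//.
  exact: le_trans (lproj_le_A0 _ _) (ltW xb).
have h3 : t * (rnorm (pi n a) + rnorm (pi m a) + 1) = d by rewrite divfK ?gt_eqF.
have t0 : 0 < t by rewrite divr_gt0.
by move: h1 h2 h3; lra.
Qed.

Lemma restricted_norm_ge0 (i : pedersen_pos K) m : (0 <= restricted_norm i m)%E.
Proof.
apply: (@le_trans _ _ (rnorm (pedersen_val (mul_l m 0)))%:E).
  by rewrite lee_fin rnorm_ge0.
apply: ereal_sup_ubound; exists 0 => //; split; last by rewrite rnorm0.
by apply: subset_closure; exists 0 => //; exact: smul0l.
Qed.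

Lemma restricted_normD (i : pedersen_pos K) (m n : multiplier (pedersen_alg K)) :
  (restricted_norm i (m + n)%R <= restricted_norm i m + restricted_norm i n)%E.
Proof.
apply: ge_ereal_sup => _ [x xi <-].
apply: (@le_trans _ _ ((rnorm (pedersen_val (mul_l m x)))%:E +
    (rnorm (pedersen_val (mul_l n x)))%:E)%E).
  by rewrite -EFinD lee_fin; exact: rnormD.
by apply: leeD; apply: ereal_sup_ubound; exists x.
Qed.

Definition rrestricted (i : pedersen_pos K) (m : multiplier (pedersen_alg K)) : R :=
  fine (restricted_norm i m).

(** Finiteness comes from surjectivity of [K_mult]: the multiplier is multiplication by some [a],
    and its seminorm is at most [|pi_n a|]. *)
Lemma rrestrictedE i m : restricted_norm i m = (rrestricted i m)%:E.
Proof.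
rewrite fineK// ge0_fin_numE ?restricted_norm_ge0//.
have [a <-] := K_mult_surj m; have [n h] := restricted_norm_le i.
exact: le_lt_trans (h a) (ltry _).
Qed.

Lemma rrestricted_ge0 i m : 0 <= rrestricted i m.
Proof. by rewrite -lee_fin -rrestrictedE restricted_norm_ge0. Qed.

Lemma rrestrictedD i m n : rrestricted i (m + n) <= rrestricted i m + rrestricted i n.
Proof.
by have := restricted_normD i m n; rewrite !rrestrictedE -EFinD lee_fin.
Qed.

Lemma lproj_le_restricted n : exists i, forall a,
  rnorm (pi n a) <= rrestricted i (K_mult L a).
Proof.
(* The square is a positive element of A_0, and y = y e_(n+1)^2 for y = y e_(n+1). *)
pose E := K_seq L n.+1.
have pE : positive (pedersen_val (E ** E)).
  exists (pedersen_val E); apply: A0_inj.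
  by rewrite -[RHS]/(star (e n.+1) ** e n.+1) lc_star.
exists (exist _ (E ** E) pE) => a; apply: lproj_le_sup => y y1 ye.
have Jy : J (A0_val y) by rewrite -ye; exact: A00_er.
rewrite -rrestrictedE; apply: ereal_sup_ubound; exists (K_in Jy); last first.
  by rewrite rnorm_A0.
split=> //; apply: subset_closure; exists y => //; apply: A0_inj.
by rewrite -[LHS]/(A0_val y ** (e n.+1 ** e n.+1)) smulA !ye.
Qed.

Lemma K_mult_homeo :
  @homeomorphism (proj_topology L) (Gamma_proj_topology K) (@K_mult _ _ L).
Proof.
have [[Klin _ _] [g gK Kg]] := K_mult_iso L.
have KB := linear_sub Klin.
have gB m n : g (m - n) = g m - g n by rewrite -{1}(Kg m) -{1}(Kg n) -KB gK.
have lnD n (a b : A) : rnorm (pi n (a + b)) <= rnorm (pi n a) + rnorm (pi n b).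
  by rewrite lprojD rnormD.
split; last exists g; last split=> //.
- apply: (@seminorm_continuous _ _ _ _ _ (lnorm L) (fun n a => rnorm (pi n a))
    (@restricted_norm _ _ K) rrestricted) => //.
  + exact: rrestrictedE.
  + by move=> i x; exact: rnorm_ge0.
  + by move=> i; rewrite lproj0 rnorm0.
  + exact: rrestrictedD.
  + move=> k; have [n hn] := restricted_norm_le k; exists n, 1 => x.
    by rewrite mul1r -lee_fin -rrestrictedE.
- apply: (@seminorm_continuous _ _ _ _ _ (@restricted_norm _ _ K) rrestricted
    (lnorm L) (fun n a => rnorm (pi n a))) => //.
  + exact: rrestrictedE.
  + exact: rrestricted_ge0.
  + move=> i; apply/eqP; rewrite eq_le rrestricted_ge0 andbT.
    have [n hn] := restricted_norm_le i.
    rewrite -lee_fin -rrestrictedE -(linear_zero Klin) (le_trans (hn _))//.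
    by rewrite lproj0 rnorm0.
  + move=> n; have [i hi] := lproj_le_restricted n; exists i, 1 => m.
    by rewrite mul1r -{2}(Kg m).
Qed.

End ProjectiveTopology.

(** * Multipliers of A_0 as bounded elements of A *)

Section BoundedMultipliers.
Variables (R : realType) (A : starAlgType R) (L : lc_sigma_cstar A).
Local Notation e := (lc_seq L).
Local Notation J := (A00 e).
Local Notation pi n := (lproj L n).
Local Notation K := (A00_pedersen L).

Let nd (v : A0 L) : star v ** v = 0 -> v = 0.
Proof. exact: star_smul_eq0. Qed.

Definition Ab_mull (a : Ab L) (x : A0 L) : A0 L :=
  @subalg_in _ _ (closure_subalg (A00_subalg L)) _ (@closure_mull _ _ L a x).
Definition Ab_mulr (a : Ab L) (x : A0 L) : A0 L :=
  @subalg_in _ _ (closure_subalg (A00_subalg L)) _ (@closure_mulr _ _ L a x).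

Definition Ab_mult (a : Ab L) : multiplier (A0 L).
Proof.
refine (@Multiplier _ _ (Ab_mull a) (Ab_mulr a) _).
by move=> x y; apply: A0_inj; exact: smulA.
Defined.

Lemma rnorm_Ab_mull a x : rnorm (Ab_mull a x) <= rnorm a * rnorm x.
Proof. exact: (rnormM a (closure_val x)). Qed.

Lemma Ab_mult_norm a : multiplier_norm (Ab_mult a) = (rnorm a)%:E.
Proof.
have le_a : (multiplier_norm (Ab_mult a) <= (rnorm a)%:E)%E.
  apply: ge_ereal_sup => _ [x /= x1 <-]; rewrite lee_fin.
  by rewrite (le_trans (rnorm_Ab_mull _ _))// ler_piMr ?rnorm_ge0.
have ge0 : (0 <= multiplier_norm (Ab_mult a))%E.
  apply: (@le_trans _ _ (rnorm (Ab_mull a 0))%:E); first by rewrite lee_fin rnorm_ge0.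
  by apply: ereal_sup_ubound; exists 0 => //=; rewrite rnorm0.
apply/eqP; rewrite eq_le le_a /=.
have fin : multiplier_norm (Ab_mult a) \is a fin_num.
  by rewrite ge0_fin_numE// (le_lt_trans le_a)// ltry.
rewrite -(fineK fin) rnorm_Ab; apply/infnorm_leP => n.
apply: lproj_le_sup => y y1 _; rewrite fineK//.
apply: ereal_sup_ubound; exists y => //; exact: (rnorm_A0 (Ab_mull a y)).
Qed.

(** Generators of A_00 factor as [y z] with [y] and [z] in A_00, and [S(y z) = S(y) z],
    [T(y z) = y T(z)]. *)
Lemma mult_A00 (m : multiplier (A0 L)) (x : A0 L) : J (A0_val x) ->
  J (A0_val (mul_l m x)) /\ J (A0_val (mul_r m x)).
Proof.
suff h a : J a -> exists2 y, A0_val y = a &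
    J (A0_val (mul_l m y)) /\ J (A0_val (mul_r m y)).
  by move=> /h[y /A0_inj ->].
have rD y z : mul_r m (y + z) = mul_r m y + mul_r m z.
  by apply: (smul_rcancel nd) => w; rewrite smulDl -!multiplierP smulDl.
have rZ c y : mul_r m (c *: y) = c *: mul_r m y.
  by apply: (smul_rcancel nd) => w; rewrite smulZl -!multiplierP smulZl.
have l0 := linear_zero (mul_l_linear nd m).
have r0 : mul_r m 0 = 0 by have := rZ 0 0; rewrite !scale0r.
have J0 : J 0 by exists 0%N; exact: lspan0.
have JZ c z : J z -> J (c *: z) by move=> [n zn]; exists n; exact: lspanZ.
move=> [k]; move: a; apply: lspan_ind.
- by exists 0 => //; rewrite l0 r0.
- move=> _ _ [y <- [h1 h2]] [z <- [h3 h4]]; exists (y + z) => //.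
  rewrite (linear_add (mul_l_linear nd m)) rD.
  by split; exact: A00_add.
- move=> c _ [y <- [h1 h2]]; exists (c *: y) => //.
  rewrite (linear_scale (mul_l_linear nd m)) rZ.
  by split; exact: JZ.
- move=> _ [b [c ->]].
  exists (A00_to_A0 (A00_er L k b) ** A00_to_A0 (A00_e L k c)).
    by rewrite -[LHS]/(b ** e k ** (e k ** c)) !smulA.
  rewrite (mul_lM nd) (mul_rM nd); split.
    by apply: A00_mull; exact: A00_e.
  by apply: A00_mulr; exact: A00_er.
Qed.

(** The restriction of [m] to A_00 is multiplication by some [a] in [A]. Automatic boundedness of
    [m] puts [a] in A_b, and density of A_00 extends the agreement to A_0. *)
Lemma Ab_mult_surj (m : multiplier (A0 L)) : exists a, Ab_mult a = m.
Proof.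
have Jl (x : pedersen_alg K) : J (A0_val (mul_l m (pedersen_val x))).
  by have [] := mult_A00 m (K_valP x).
have Jr (x : pedersen_alg K) : J (A0_val (mul_r m (pedersen_val x))).
  by have [] := mult_A00 m (K_valP x).
have mK (x y : pedersen_alg K) : x ** K_in (Jl y) = K_in (Jr x) ** y.
  apply: K_inj.
  exact: (congr1 (@A0_val _ _ L) (multiplierP m (pedersen_val x) (pedersen_val y))).
have [a am] := K_mult_surj (Multiplier mK).
have aJ (x : pedersen_alg K) : a ** K_val x = A0_val (mul_l m (pedersen_val x)).
  exact: (congr1 (fun n => K_val (mul_l n x)) am).
have [C hC] := multiplier_l_bounded m.
have ab : bounded_elt L a.
  apply/bounded_eltP; exists `|C| => n; apply: lproj_le_sup => y y1 ye.
  have Jy : J (A0_val y) by rewrite -ye; exact: A00_er.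
  rewrite -[A0_val y]/(K_val (K_in Jy)) aJ -rnorm_A0 lee_fin.
  rewrite (le_trans (hC _))// (le_trans (ler_wpM2r (rnorm_ge0 _) (ler_norm C)))//.
  by rewrite ler_piMr.
exists (to_Ab ab); apply: (mul_l_inj nd); apply/funext => x /=.
apply/eqP; rewrite -subr_eq0; apply/eqP/rnorm_small_eq0 => d d0.
have C0 : 0 < rnorm (to_Ab ab) + `|C| + 1.
  by rewrite ltr_wpDl// addr_ge0 ?rnorm_ge0.
have [y Jy xy] := A0_approx x (divr_gt0 d0 C0).
have ay : Ab_mull (to_Ab ab) y = mul_l m y.
  have yE : pedersen_val (K_in Jy) = y by exact: A0_inj.
  by rewrite -yE; apply: A0_inj; exact: (aJ (K_in Jy)).
have -> : Ab_mull (to_Ab ab) x - mul_l m x =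
    Ab_mull (to_Ab ab) (x - y) - mul_l m (x - y).
  have -> : Ab_mull (to_Ab ab) (x - y) = Ab_mull (to_Ab ab) x - Ab_mull (to_Ab ab) y.
    by apply: A0_inj; exact: smulBr.
  rewrite (linear_sub (mul_l_linear nd m)) ay.
  by rewrite opprB addrA subrK.
rewrite (le_lt_trans (rnormB _ _))//.
rewrite ltr_pdivlMr// in xy; apply: le_lt_trans xy; rewrite mulrC !mulrDl mul1r.
rewrite -addrA lerD ?rnorm_Ab_mull// (le_trans (hC _))//.
by rewrite (le_trans (ler_wpM2r (rnorm_ge0 _) (ler_norm C)))// lerDl rnorm_ge0.
Qed.

Lemma Ab_mult_iso : star_iso Ab_mult.
Proof.
have lin : linear Ab_mult.
  move=> k a b; apply: multiplier_eq; apply/funext => x; apply: A0_inj.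
    by rewrite -[LHS]/((k *: Ab_val a + Ab_val b) ** A0_val x) smulDl smulZl.
  by rewrite -[LHS]/(A0_val x ** (k *: Ab_val a + Ab_val b)) smulDr smulZr.
split; last first.
  apply: inj_surj_bij Ab_mult_surj => a b ab; apply/eqP; rewrite -subr_eq0.
  apply/eqP/rnorm_eq0; have := Ab_mult_norm (a - b).
  rewrite (linear_sub lin) ab subrr -(linear_zero lin) Ab_mult_norm rnorm0.
  by case=> <-.
split=> //.
- move=> a b; apply: multiplier_eq; apply/funext => x; apply: A0_inj.
    by rewrite -[LHS]/(Ab_val a ** Ab_val b ** A0_val x) -smulA.
  by rewrite -[LHS]/(A0_val x ** (Ab_val a ** Ab_val b)) smulA.
- move=> a; apply: multiplier_eq; apply/funext => x; apply: A0_inj.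
    by rewrite -[RHS]/(star (star (A0_val x) ** Ab_val a)) starM starK.
  by rewrite -[RHS]/(star (Ab_val a ** star (A0_val x))) starM starK.
Qed.

End BoundedMultipliers.

(** * Approximate units *)

Section ApproximateUnit.
Variables (R : realType) (B : preCstarType R) (I : set B).
Hypothesis I_ideal : two_sided_ideal I.
Implicit Types h x y z f g : B.

Let I0 : I 0. Proof. by case: I_ideal. Qed.
Let ID x y : I x -> I y -> I (x + y). Proof. by case: I_ideal => _ h _ _; exact: h. Qed.
Let IZ (c : R[i]) x : I x -> I (c *: x). Proof. by case: I_ideal => _ _ h _; exact: h. Qed.
Let IMl x y : I y -> I (x ** y). Proof. by case: I_ideal => _ _ _ h /(h _ x)[]. Qed.
Let IMr x y : I x -> I (x ** y). Proof. by case: I_ideal => _ _ _ h /(h _ y)[]. Qed.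

Local Notation M := (expR 1 : R).

Let M1 : 1 <= M. Proof. by rewrite -[leLHS]expR0 ler_expR. Qed.
Let M0 : 0 < M. Proof. exact: expR_gt0. Qed.

(* The operator U = 1 - i d h satisfies U^* U = 1 + d^2 h^2, hence
   |U|^2 <= 1 + d^2, and its powers up to 1/d^2 are uniformly bounded.  By
   telescoping, i d h G = (1 - U^N) / N for the mean G = 1 - f of the powers U^k,
   k < N = 1/d^2, so that |h G| = O(d). *)
Lemma mean_ergodic h n : star h = h -> rnorm h <= 1 -> I h ->
  exists f, [/\ I f, f ** h = h ** f, forall y, rnorm (y - f ** y) <= M * rnorm y &
    forall y, rnorm (h ** (y - f ** y)) <= (1 + M) / n.+1%:R * rnorm y].
Proof.
move=> hh h1 Ih; pose d : R := n.+1%:R^-1; pose N := (n.+1 * n.+1)%N.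
have d0 : 0 < d by rewrite invr_gt0.
have dN : d ^+ 2 * N%:R = 1.
  by rewrite /N natrM expr2 -mulrA mulKf ?pnatr_eq0// mulVf ?pnatr_eq0.
have N0 : 0 < N%:R :> R by rewrite ltr0n muln_gt0.
pose c : R[i] := (0 +i* d)%C.
have cc : c * c = - ((d ^+ 2)%:C)%C.
  by apply/eqP; rewrite eq_complex /= !mul0r !mulr0 sub0r addr0 oppr0 expr2 !eqxx.
have cJ : c^* = - c by apply/eqP; rewrite eq_complex /= oppr0 !eqxx.
pose U y := y - c *: (h ** y).
have U_norm y : rnorm (U y) ^+ 2 <= (1 + d ^+ 2) * rnorm y ^+ 2.
  rewrite -rnorm_star_smul.
  have -> : star (U y) ** U y =
      star y ** y + ((d ^+ 2)%:C)%C *: (star y ** h ** (h ** y)).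
    rewrite /U starB starZ starM hh cJ scaleNr opprK smulDl !smulBr.
    by rewrite !smulZl !smulZr !smulA scalerA cc scaleNr opprK addrA subrK.
  rewrite (le_trans (rnormD _ _))// mulrDl mul1r lerD ?rnorm_star_smul//.
  rewrite rnormZr ?sqr_ge0// ler_wpM2l ?sqr_ge0//.
  rewrite (le_trans (rnormM _ _))// expr2.
  rewrite ler_pM ?rnorm_ge0// (le_trans (rnormM _ _))// ?rnorm_star.
    by rewrite ler_piMr ?rnorm_ge0.
  by rewrite ler_piMl ?rnorm_ge0.
have U_iter k y : rnorm (iter k U y) ^+ 2 <= (1 + d ^+ 2) ^+ k * rnorm y ^+ 2.
  elim: k => [|k ih] /=; first by rewrite expr0 mul1r.
  rewrite (le_trans (U_norm _))// [_ ^+ k.+1]exprS -mulrA ler_wpM2l//.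
  by rewrite addr_ge0// sqr_ge0.
have U_bound k y : (k <= N)%N -> rnorm (iter k U y) <= M * rnorm y.
  move=> kN; rewrite -ler_sqr ?nnegrE ?mulr_ge0 ?rnorm_ge0 ?(ltW M0)//.
  rewrite (le_trans (U_iter _ _))// exprMn ler_wpM2r ?sqr_ge0//.
  have d1 : 1 <= 1 + d ^+ 2 by rewrite lerDl sqr_ge0.
  apply: (@le_trans _ _ ((1 + d ^+ 2) ^+ N)); first by rewrite ler_weXn2l.
  apply: (@le_trans _ _ M); last by rewrite expr2 ler_peMl ?(ltW M0).
  (* Origin of the constant: [(1 + d^2)^N <= exp (d^2 N)] with [d^2 N = 1], whatever [n] is. *)
  have -> : M = expR (d ^+ 2) ^+ N by rewrite -expRM_natr dN.
  apply: lerXn2r; rewrite ?nnegrE.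
  - by rewrite addr_ge0 ?sqr_ge0.
  - exact: expR_ge0.
  - exact: expR_ge1Dx.
have UE k z : c *: (h ** iter k U z) = iter k U z - iter k.+1 U z.
  by rewrite /= /U subKr.
have telescope k z : c *: (h ** \sum_(j < k) iter j U z) = z - iter k U z.
  elim: k => [|k ih]; first by rewrite big_ord0 smul0r scaler0 subrr.
  by rewrite big_ord_recr /= smulDr scalerDr ih UE addrA subrK.
(* [F k] stands for [1 - U^k], obtained inside the ideal by a recursion without a unit. *)
pose F := fix F k : B := if k is k'.+1 then F k' + c *: (h - h ** F k') else 0.
have FU k y : iter k U y = y - F k ** y.
  elim: k => [|k ih]; first by rewrite smul0l subr0.
  by rewrite iterS ih /U /= smulDl opprD addrA smulZl smulBl -smulA smulBr.
have FI k : I (F k).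
  elim: k => //= k ih; apply: ID => //; apply/IZ/ID => //.
  by rewrite -scaleN1r; apply/IZ/IMr.
have Fh k : F k ** h = h ** F k.
  elim: k => [|k ih] /=; first by rewrite smul0l smul0r.
  by rewrite smulDl smulDr ih smulZl smulZr smulBl smulBr -!smulA ih.
pose r := ((N%:R^-1 : R)%:C)%C; pose S := \sum_(k < N) F k.
have sumM k y : (\sum_(j < k) F j) ** y = \sum_(j < k) F j ** y.
  by apply: (big_morph (smul^~ y)) => [u v|]; rewrite ?smulDl ?smul0l.
have GE y : y - (r *: S) ** y = r *: \sum_(k < N) iter k U y.
  have -> : \sum_(k < N) iter k U y = y *+ N - S ** y.
    rewrite sumM; under eq_bigr do rewrite FU.
    by rewrite sumrB sumr_const card_ord.
  rewrite smulZl scalerBr -scaler_nat scalerA.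
  have -> : r * N%:R = 1.
    by rewrite /r -(rmorph_nat (real_complex R)) -rmorphM /= mulVf ?gt_eqF.
  by rewrite scale1r.
have r0 : 0 <= N%:R^-1 :> R by rewrite invr_ge0 ltW.
exists (r *: S); split.
- by apply: IZ; apply: big_ind => // k _; exact: FI.
- rewrite smulZl smulZr sumM; congr (_ *: _).
  rewrite (big_morph (smul h) (id1 := 0) (op1 := +%R)) => [|u v|];
    last by rewrite smul0r.
    by apply: eq_bigr => k _; exact: Fh.
  by rewrite smulDr.
- move=> y; rewrite GE rnormZr// mulrC ler_pdivrMr// mulrAC.
  have -> : M * N%:R * rnorm y = \sum_(k < N) M * rnorm y.
    by rewrite sumr_const card_ord mulrAC mulr_natr.
  elim/big_rec2: _ => [|k u v _ uv]; first by rewrite rnorm0.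
  by rewrite (le_trans (rnormD _ _))// lerD// U_bound// ltnW.
- move=> y; rewrite GE smulZr rnormZr//.
  have := congr1 (@rnorm _ _) (telescope N y).
  have cd : Normc.normc c = d by rewrite /= expr0n add0r sqrtr_sqr gtr0_norm.
  rewrite rnormZ cd => hd.
  have : d * rnorm (h ** \sum_(k < N) iter k U y) <= (1 + M) * rnorm y.
    by rewrite hd (le_trans (rnormB _ _))// mulrDl mul1r lerD// U_bound.
  have dE : N%:R^-1 = d * d by rewrite /N natrM invfM.
  by rewrite dE => /(ler_wpM2l (ltW d0)); rewrite !mulrA [d * (1 + _)]mulrC.
Qed.

(** [mean_ergodic] needs a self-adjoint element, so [h = z ** star z]. With [G = 1 - f], the
    C*-identity gives [|G z|^2 <= M |G h|] and [|G h|^2 <= M |G h h| = M |h G h|], the last equality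
    because [f] commutes with [h]. Two squarings account for [e ^+ 4] in the choice of [n]. *)
Lemma approx_unit1 z (e : R) : I z -> 0 < e ->
  exists f, [/\ I f, forall y, rnorm (y - f ** y) <= M * rnorm y &
    rnorm (z - f ** z) < e].
Proof.
wlog z1 : z e / rnorm z <= 1.
  move=> wl Iz e0; pose t := (rnorm z + 1)^-1.
  have t0 : 0 < t by rewrite invr_gt0 ltr_wpDl// rnorm_ge0.
  have [|||f [If fb fz]] := wl (((t)%:C)%C *: z) (t * e).
  - rewrite rnormZr ?(ltW t0)// mulrC ler_pdivrMr ?mul1r ?lerDl//.
    by rewrite ltr_wpDl// rnorm_ge0.
  - exact: IZ.
  - exact: mulr_gt0.
  exists f; split=> //; move: fz.
  by rewrite smulZr -scalerBr rnormZr ?(ltW t0)// ltr_pM2l.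
move=> Iz e0; pose h := z ** star z.
have hh : star h = h by rewrite /h starM starK.
have h1 : rnorm h <= 1 by rewrite rnorm_smul_star expr_le1// rnorm_ge0.
have Ih : I h by exact: IMr.
have [n nP] : exists n : nat, M ^+ 3 * (1 + M) / e ^+ 4 < n.+1%:R.
  by exists (Num.truncn (M ^+ 3 * (1 + M) / e ^+ 4)); exact: truncnS_gt.
have [f [If fh fb hf]] := mean_ergodic n hh h1 Ih.
exists f; split=> //.
pose G y := y - f ** y; have Gh y w : G y ** w = G (y ** w).
  by rewrite /G smulBl smulA.
have GG x : rnorm (G x) ^+ 2 <= M * rnorm (G (x ** star x)).
  rewrite -rnorm_smul_star Gh (le_trans (fb _))//.
  rewrite ler_wpM2l ?(ltW M0)// -rnorm_star starM starK Gh//.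
have a1 : rnorm (G z) ^+ 2 <= M * rnorm (G h) by exact: GG.
have a2 : rnorm (G h) ^+ 2 <= M * ((1 + M) / n.+1%:R).
  rewrite (le_trans (GG h))// ler_wpM2l ?(ltW M0)// hh.
  have -> : G (h ** h) = h ** G h.
    by rewrite /G smulBr (smulA f h h) {1}fh -(smulA h f h).
  by rewrite (le_trans (hf h))// ler_piMr// mulr_ge0 ?invr_ge0.
have n0 : 0 < n.+1%:R :> R by [].
have a3 : (rnorm (G z) ^+ 2) ^+ 2 < (e ^+ 2) ^+ 2.
  apply: (@le_lt_trans _ _ (M ^+ 2 * rnorm (G h) ^+ 2)).
    by rewrite -exprMn lerXn2r ?nnegrE ?mulr_ge0 ?rnorm_ge0 ?sqr_ge0 ?(ltW M0).
  apply: (@le_lt_trans _ _ (M ^+ 2 * (M * ((1 + M) / n.+1%:R)))).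
    by rewrite ler_wpM2l// sqr_ge0.
  have -> : M ^+ 2 * (M * ((1 + M) / n.+1%:R)) = M ^+ 3 * (1 + M) / n.+1%:R.
    by rewrite mulrA -exprSr mulrA.
  by rewrite -exprM ltr_pdivrMr// [ltRHS]mulrC -ltr_pdivrMr// exprn_gt0.
move: a3; rewrite ltr_sqr ?nnegrE ?sqr_ge0// ltr_sqr ?nnegrE ?rnorm_ge0// ltW//.
Qed.

(** The new unit satisfies [1 - f' = (1 - g) (1 - f)], where [g] is adapted to the residue
    [z - f ** z]. It costs a factor [M] on the earlier elements, whence [e / M] in the induction
    hypothesis. *)
Lemma approx_unit_left (s : seq B) (e : R) : (forall z, z \in s -> I z) -> 0 < e ->
  exists f, [/\ I f, forall y, rnorm (y - f ** y) <= M ^+ size s * rnorm y &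
    forall z, z \in s -> rnorm (z - f ** z) < e].
Proof.
elim: s e => [|z s ih] e Is e0.
  by exists 0; split=> // y; rewrite smul0l subr0 expr0 mul1r.
have [|f [If fb fs]] := ih (e / M) _ (divr_gt0 e0 M0).
  by move=> y ys; apply: Is; rewrite inE ys orbT.
have Iz : I z by apply: Is; rewrite inE eqxx.
have Iz' : I (z - f ** z) by apply: ID => //; rewrite -scaleN1r; exact/IZ/IMl.
have [g [Ig gb gz]] := approx_unit1 Iz' e0.
have E y : y - (f + g - g ** f) ** y = (y - f ** y) - g ** (y - f ** y).
  by rewrite smulBr smulA smulBl smulDl !opprD !opprK !addrA.
exists (f + g - g ** f); split.
- by apply: ID; [exact: ID|rewrite -scaleN1r; exact/IZ/IMl].
- move=> y; rewrite E (le_trans (gb _))// exprS -mulrA.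
  by rewrite ler_wpM2l ?(ltW M0).
- move=> y; rewrite inE E => /orP[/eqP -> //|ys].
  by rewrite (le_lt_trans (gb _))// mulrC -ltr_pdivlMr// fs.
Qed.

(** A self-adjoint [g] with [1 - g = star (1 - f) (1 - f)], adapted to the list and its adjoints,
    works on both sides. *)
Lemma approx_unit (s : seq B) (e : R) : (forall z, I z -> I (star z)) ->
  (forall z, z \in s -> I z) -> 0 < e ->
  exists2 g, I g & forall z, z \in s ->
    rnorm (z - g ** z) < e /\ rnorm (z - z ** g) < e.
Proof.
move=> IS Is e0; pose s' := s ++ map (@star R B) s; pose C := M ^+ size s'.
have C0 : 0 < C by exact: exprn_gt0.
have [|f [If fb fs]] := @approx_unit_left s' (e / C) _ (divr_gt0 e0 C0).
  by move=> z; rewrite mem_cat => /orP[/Is//|/mapP[y ys ->]]; exact/IS/Is.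
pose g := f + star f - star f ** f.
have gg : star g = g.
  by rewrite /g starB starD starM !starK (addrC f).
(* The bound for [1 - f] passes to its adjoint: if [v = w - star f ** w], then [|v|^2 = |star w **
   (v - f ** v)| <= C |w| |v|]. *)
have fb' w : rnorm (w - star f ** w) <= C * rnorm w.
  set v := w - _; have [->|v0] := eqVneq (rnorm v) 0.
    by rewrite mulr_ge0 ?rnorm_ge0 ?ltW.
  have vp : 0 < rnorm v by rewrite lt0r v0 rnorm_ge0.
  rewrite -(ler_pM2r vp) -expr2 -rnorm_star_smul.
  have -> : star v ** v = star w ** (v - f ** v).
    by rewrite {1}/v starB starM starK smulBl -smulA (smulBr _ v (f ** v)).
  rewrite (le_trans (rnormM _ _))// rnorm_star mulrC -(mulrC (rnorm v)) mulrA.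
  by rewrite ler_wpM2r ?rnorm_ge0// mulrC.
have gb z : z \in s' -> rnorm (z - g ** z) < e.
  move=> /fs zs; have -> : z - g ** z = (z - f ** z) - star f ** (z - f ** z).
    by rewrite /g smulBr smulA smulBl smulDl !opprD !opprK !addrA.
  by rewrite (le_lt_trans (fb' _))// mulrC -ltr_pdivlMr.
exists g.
  apply: ID; first by apply: ID => //; exact: IS.
  by rewrite -scaleN1r; exact/IZ/IMl.
move=> z zs; split; first by apply: gb; rewrite mem_cat zs.
rewrite -rnorm_star starB starM gg; apply: gb.
by rewrite mem_cat map_f ?orbT.
Qed.

End ApproximateUnit.

(** * Extension to the completions *)

Definition pedersen_in (R : realType) (B : cstarType R) (K : pedersen B) (x : B)
    (Kx : (K : set B) x) : pedersen_alg K :=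
  @subalg_in _ _ (pedersen_subalg K) x Kx.

Lemma pedersen_valP (R : realType) (B : cstarType R) (K : pedersen B)
  (x : pedersen_alg K) : (K : set B) (pedersen_val x).
Proof. exact: (@subalg_valS _ _ (pedersen_subalg K) x). Qed.

Section Extension.
Variables (R : realType) (B D : cstarType R) (KB : pedersen B) (KD : pedersen D).
Local Notation valB := (@pedersen_val R B KB).
Local Notation valD := (@pedersen_val R D KD).
Variable f : pedersen_alg KB -> pedersen_alg KD.
Hypothesis f_iso : star_iso f.
Hypothesis f_norm : forall x, rnorm (valD (f x)) = rnorm (valB x).

(** The closure of the graph of [f]. As a relation it is compatible with the operations before any
    choice of approximating sequences. *)
Let graph (b : B) (d : D) := exists u : nat -> pedersen_alg KB,
  rcvg (fun n => valB (u n)) b /\ rcvg (fun n => valD (f (u n))) d.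

Lemma pedersen_seq (E : cstarType R) (K : pedersen E) (x : E) :
  exists u : nat -> pedersen_alg K, rcvg (fun n => pedersen_val (u n)) x.
Proof.
have [_ Kd _] := pedersenP K.
have /choice[u uP] n : exists k : pedersen_alg K,
    rnorm (x - pedersen_val k) < n.+1%:R^-1.
  have [|y Ky xy] := @dense_approx _ _ _ x (n.+1%:R^-1 : R) Kd.
    by rewrite invr_gt0.
  by exists (pedersen_in Ky).
exists u => e e0; exists (Num.truncn e^-1) => n Nn.
rewrite rnorm_dist (lt_le_trans (uP n))// invf_ple ?posrE//.
rewrite (le_trans (ltW (truncnS_gt _)))//.
by rewrite ler_nat ltnS.
Qed.

Lemma graph_total b : exists d, graph b d.
Proof.
have [u ub] := pedersen_seq KB b; have [[flin _ _] _] := f_iso.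
have [d ud] : exists d, rcvg (fun n => valD (f (u n))) d.
  apply: rcauchy_cvg => e e0; have [N hN] := ub _ (half_gt0 e0); exists N => n Nn.
  have -> : valD (f (u n)) - valD (f (u N)) = valD (f (u n - u N)).
    by rewrite (linear_sub flin).
  rewrite f_norm -[valB _]/(valB (u n) - valB (u N)).
  rewrite (le_lt_trans (rnorm_triangle b _ _))// [ltRHS](splitr e) ltrD ?hN//.
  by rewrite rnorm_dist hN.
by exists d, u.
Qed.

Lemma graph_norm b d : graph b d -> rnorm d = rnorm b.
Proof.
move=> [u [ub ud]]; apply/eqP; rewrite eq_le; apply/andP; split.
  by apply: (rcvg_norm_le ud ub) => n; rewrite f_norm.
by apply: (rcvg_norm_le ub ud) => n; rewrite f_norm.
Qed.

Lemma graph_lin k b d b' d' : graph b d -> graph b' d' ->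
  graph (k *: b + b') (k *: d + d').
Proof.
move=> [u [ub ud]] [v [vb vd]]; have [[flin _ _] _] := f_iso.
exists (fun n => k *: u n + v n); split; first by apply: rcvgD => //; exact: rcvgZ.
under eq_fun do rewrite flin.
by apply: rcvgD => //; exact: rcvgZ.
Qed.

Lemma graph_mul b d b' d' : graph b d -> graph b' d' -> graph (b ** b') (d ** d').
Proof.
move=> [u [ub ud]] [v [vb vd]]; have [[_ fM _] _] := f_iso.
exists (fun n => u n ** v n); split; first exact: rcvgM.
by under eq_fun do rewrite fM; exact: rcvgM.
Qed.

Lemma graph_star b d : graph b d -> graph (star b) (star d).
Proof.
move=> [u [ub ud]]; have [[_ _ fS] _] := f_iso.
exists (fun n => star (u n)); split; first exact: rcvg_star.
by under eq_fun do rewrite fS; exact: rcvg_star.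
Qed.

Lemma graph_fun b d d' : graph b d -> graph b d' -> d = d'.
Proof.
move=> h h'; have := graph_norm (graph_lin (-1) h h').
rewrite !scaleN1r addNr rnorm0 => /rnorm_eq0/eqP.
by rewrite addrC subr_eq0 => /eqP.
Qed.

End Extension.

Lemma cstar_isomorphic_of_pedersen (R : realType) (B D : cstarType R)
    (KB : pedersen B) (KD : pedersen D) (f : pedersen_alg KB -> pedersen_alg KD) :
  star_iso f -> (forall x, rnorm (pedersen_val (f x)) = rnorm (pedersen_val x)) ->
  cstar_isomorphic B D.
Proof.
move=> fi fn; have [F FP] := choice (graph_total fi fn).
have Flin : linear F.
  move=> k x y; apply: (graph_fun fi fn (FP _)).
  exact: (graph_lin fi _ (FP x) (FP y)).
exists F; last first.
  by move=> x; rewrite !rnormE (graph_norm fn (FP x)).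
split; first split=> //.
- move=> x y; apply: (graph_fun fi fn (FP _)).
  exact: (graph_mul fi (FP x) (FP y)).
- move=> x; apply: (graph_fun fi fn (FP _)).
  exact: (graph_star fi (FP x)).
apply: inj_surj_bij.
  move=> x y xy; apply/eqP; rewrite -subr_eq0; apply/eqP/rnorm_eq0.
  by rewrite -(graph_norm fn (FP _)) (linear_sub Flin) xy subrr rnorm0.
move=> d; have [v vd] := pedersen_seq KD d.
have [[flin _ _] [g fK gK]] := fi.
have [b ub] : exists b, rcvg (fun n => pedersen_val (g (v n))) b.
  apply: rcauchy_cvg => e e0; have [N hN] := vd _ (half_gt0 e0); exists N => n Nn.
  have -> : pedersen_val (g (v n)) - pedersen_val (g (v N)) =
    pedersen_val (g (v n) - g (v N)) by [].
  rewrite -fn (linear_sub flin) !gK.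
  rewrite -[pedersen_val _]/(pedersen_val (v n) - pedersen_val (v N)).
  rewrite (le_lt_trans (rnorm_triangle d _ _))// [ltRHS](splitr e) ltrD ?hN//.
  by rewrite rnorm_dist hN.
exists b; apply: (graph_fun fi fn (FP _)).
by exists (fun n => g (v n)); split=> //; under eq_fun do rewrite gK.
Qed.

(** * Uniqueness *)

Definition inner_multiplier (R : realType) (J : starAlgType R) (k : J) : multiplier J :=
  @Multiplier R J (smul k) (smul^~ k) (fun x y => smulA x k y).

(** Inner multipliers pulled back along [phi] embed [K] as an ideal of [A], on which [phi a] acts as
    multiplication by [a]. Two such ideals can then be compared inside [A]. *)
Lemma pedersen_embedding (R : realType) (A : starAlgType R) (B : cstarType R)
    (K : pedersen B) (phi : A -> multiplier (pedersen_alg K)) : star_iso phi ->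
  exists i : pedersen_alg K -> A, [/\ star_hom i, injective i,
    forall x, phi (i x) = inner_multiplier x,
    forall a x, a ** i x = i (mul_l (phi a) x) &
    forall a x, i x ** a = i (mul_r (phi a) x)].
Proof.
move=> [[plin pM pS] [g pK gK]]; have nd := @pedersen_nd _ _ K.
have pinj := can_inj pK; pose i x := g (inner_multiplier x).
have iE x : phi (i x) = inner_multiplier x by exact: gK.
have il a x : a ** i x = i (mul_l (phi a) x).
  apply: pinj; rewrite pM !iE; apply: multiplier_eq; apply/funext => y /=.
    exact: mul_lM.
  by rewrite multiplierP.
have ir a x : i x ** a = i (mul_r (phi a) x).
  apply: pinj; rewrite pM !iE; apply: multiplier_eq; apply/funext => y /=.
    by rewrite multiplierP.
  exact: mul_rM.
exists i; split=> //.
- split.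
  + move=> k x y; apply: pinj; rewrite plin !iE.
    apply: multiplier_eq; apply/funext => z /=; first by rewrite smulDl smulZl.
    by rewrite smulDr smulZr.
  + by move=> x y; rewrite il iE.
  + move=> x; apply: pinj; rewrite pS !iE.
    by apply: multiplier_eq; apply/funext => z /=; rewrite starM starK.
- move=> x y /(congr1 phi); rewrite !iE => xy.
  by apply: (smul_rcancel nd) => z; exact: (congr1 (fun m => mul_l m z) xy).
Qed.

Definition rkappa (R : realType) (B : cstarType R) (K : pedersen B)
    (k : pedersen_alg K + pedersen_alg K) (m : multiplier (pedersen_alg K)) : R :=
  match k with
  | inl x => rnorm (pedersen_val (mul_l m x))
  | inr x => rnorm (pedersen_val (mul_r m x))
  end.

Lemma rkappaE (R : realType) (B : cstarType R) (K : pedersen B)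
    (k : pedersen_alg K + pedersen_alg K) m : kappa_seminorm k m = (rkappa k m)%:E.
Proof. by case: k. Qed.

(** Continuity of [psi] after the inverse of [phi], in quantitative form. *)
Definition kappa_dominated (R : realType) (X : Type) (B D : cstarType R)
    (KB : pedersen B) (KD : pedersen D) (phi : X -> multiplier (pedersen_alg KB))
    (psi : X -> multiplier (pedersen_alg KD)) : Prop :=
  forall k, exists (s : seq (pedersen_alg KB + pedersen_alg KB)) (C : R),
    forall a, rkappa k (psi a) <= C * \sum_(c <- s) rkappa c (phi a).

(** [T] will be [A] with its A_00-topology, here a bare topological space; homogeneity is therefore
    stated through the values of [phi] and [psi]. *)
Lemma homeo_kappa_dominated (R : realType) (T : topologicalType)
    (B D : cstarType R) (KB : pedersen B) (KD : pedersen D)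
    (phi : T -> Gamma_kappa_topology KB) (psi : T -> Gamma_kappa_topology KD) :
  homeomorphism phi -> continuous psi ->
  (forall (c : R[i]) (m : multiplier (pedersen_alg KB)) t t',
    phi t = m -> phi t' = c *: m ->
    psi t' = c *: (psi t : multiplier (pedersen_alg KD))) ->
  kappa_dominated (phi : T -> multiplier _) (psi : T -> multiplier _).
Proof.
move=> [_ [g [gK Kg gc]]] psic psiZ k.
pose f (m : multiplier (pedersen_alg KB)) : multiplier (pedersen_alg KD) := psi (g m).
have fZ c m : f (c *: m) = c *: f m by apply: psiZ; exact: Kg.
have fc : continuous
    (f : seminorm_topology (@kappa_seminorm _ _ KB) ->
         seminorm_topology (@kappa_seminorm _ _ KD)).
  by move=> m; apply: continuous_comp; [exact: gc|exact: psic].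
have [||||s [C hC]] := @seminorm_bound _ _ _ _ _ _ (@rkappa _ _ KB) _ (@rkappa _ _ KD)
  (@rkappaE _ _ KB) (@rkappaE _ _ KD) _ _ _ _ f fc fZ k.
- by move=> [x|x] m n; exact: rnormD.
- by move=> [x|x] m; exact: rnorm_ge0.
- by move=> [x|x] r m r0; exact: rnormZr.
- by move=> [x|x] r m r0; exact: rnormZr.
by exists s, C => t; have := hC (phi t); rewrite /f gK.
Qed.

(** * Two Pedersen ideals compared inside A *)

Section Comparison.
Variables (R : realType) (A : starAlgType R) (one : A).
Hypothesis one_l : forall a, one ** a = a.
Hypothesis one_r : forall a, a ** one = a.
Variables (B D : cstarType R) (KB : pedersen B) (KD : pedersen D).
Variables (phi : A -> multiplier (pedersen_alg KB)).
Variables (psi : A -> multiplier (pedersen_alg KD)).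
Hypotheses (phi_iso : star_iso phi) (psi_iso : star_iso psi).
Hypothesis phi_psi : kappa_dominated phi psi.
Variables (i : pedersen_alg KB -> A) (j : pedersen_alg KD -> A).
Hypotheses (i_hom : star_hom i) (i_inj : injective i).
Hypothesis iE : forall x, phi (i x) = inner_multiplier x.
Hypothesis il : forall a x, a ** i x = i (mul_l (phi a) x).
Hypothesis ir : forall a x, i x ** a = i (mul_r (phi a) x).
Hypotheses (j_hom : star_hom j) (j_inj : injective j).
Hypothesis jl : forall a x, a ** j x = j (mul_l (psi a) x).
Hypothesis jr : forall a x, j x ** a = j (mul_r (psi a) x).

(** The dominating seminorms are finitely many and test both [x - c x] and [x - x c], which calls
    for a two-sided approximate unit adapted to a finite list. *)
Lemma kappa_small k (e : R) : 0 < e ->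
  exists c, rkappa k (psi (one - i c)) < e.
Proof.
move=> e0; have [s [C hC]] := phi_psi k.
have C0 : 0 < `|C| + 1 by rewrite ltr_wpDl.
(* The successor of [size s] covers the empty list and makes the final inequality strict. *)
pose d := e / (`|C| + 1) / (size s).+1%:R.
have d0 : 0 < d by rewrite !divr_gt0.
pose v (x : pedersen_alg KB + pedersen_alg KB) : B :=
  match x with inl y => pedersen_val y | inr y => pedersen_val y end.
have [KI _ _] := pedersenP KB.
have [|z|g Kg gs] := @approx_unit _ _ _ KI (map v s) d _ _ d0.
- exact: pedersenS.
- by move=> /mapP[[x|x] _ ->]; exact: (pedersen_valP x).
pose c : pedersen_alg KB := pedersen_in Kg.
exists c; have [[plin _ _] _] := phi_iso.
have pc : phi (one - i c) = phi one - inner_multiplier c.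
  by rewrite (linear_sub plin) iE.
have p1l x : mul_l (phi one) x = x by apply: i_inj; rewrite -il one_l.
have p1r x : mul_r (phi one) x = x by apply: i_inj; rewrite -ir one_r.
have small x : x \in s -> rkappa x (phi (one - i c)) <= d.
  move=> xs; have /gs[h1 h2] := map_f v xs.
  rewrite pc; case: x {xs} h1 h2 => x /= h1 h2; rewrite ?p1l ?p1r ltW//.
apply: (le_lt_trans (hC _)).
have sum_le : \sum_(x <- s) rkappa x (phi (one - i c)) <= (size s)%:R * d.
  rewrite big_seq (le_trans (ler_sum _ small))// -big_seq big_const_seq.
  by rewrite count_predT iter_addr_0 mulr_natl.
have sum_ge0 : 0 <= \sum_(x <- s) rkappa x (phi (one - i c)).
  by apply: sumr_ge0 => -[x|x] _; exact: rnorm_ge0.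
apply: (@le_lt_trans _ _ ((`|C| + 1) * ((size s)%:R * d))).
  rewrite (le_trans (ler_wpM2r sum_ge0 (ler_norm C)))//.
  by rewrite ler_pM// lerDl.
have dE : (`|C| + 1) * ((size s).+1%:R * d) = e.
  by rewrite /d mulrCA (mulrCA _ _ (_ / _)); field; rewrite gt_eqF//= pnatr_eq0.
rewrite -[ltRHS]dE ltr_pM2l// ltr_pM2r// ltr_nat//.
Qed.

(* The span of K(D) K(B) K(D), computed inside A; it is an ideal of D and,
   by the approximate units, dense, so that K(D) is contained in K(B). *)
Let gen : set D :=
  [set d | exists c x y, d = pedersen_val (mul_r (psi (i c)) x ** y)].

Let nd := @pedersen_nd _ _ KD.

(** Extends [mul_rM] to left factors [z] from all of [D], as needed for an ideal of [D] and not only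
    of K(D). *)
Lemma pedersen_mul_r (m : multiplier (pedersen_alg KD)) z (x y : pedersen_alg KD) :
  pedersen_val y = z ** pedersen_val x ->
  pedersen_val (mul_r m y) = z ** pedersen_val (mul_r m x).
Proof.
move=> yE; have [[_ _ _ KM] _ _] := pedersenP KD.
have Kz : (KD : set D) (z ** pedersen_val (mul_r m x)).
  by case: (KM _ z (pedersen_valP (mul_r m x))).
rewrite -[RHS]/(pedersen_val (pedersen_in Kz)).
congr pedersen_val; apply: (smul_rcancel nd) => w; rewrite -multiplierP.
apply: subalg_inj; rewrite -[LHS]/(pedersen_val y ** pedersen_val (mul_l m w)).
have xw : pedersen_val x ** pedersen_val (mul_l m w) =
    pedersen_val (mul_r m x) ** pedersen_val w.
  exact: (congr1 (@pedersen_val _ _ KD) (multiplierP m x w)).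
by rewrite yE -smulA xw smulA.
Qed.

(** In [gen], [x] absorbs factors of [D] on the left and [y] those on the right. *)
Lemma gen_ideal : two_sided_ideal (lspan gen).
Proof.
have [[_ _ _ KM] _ _] := pedersenP KD.
split; [exact: lspan0|exact: lspanD|exact: lspanZ|] => x b xg; split.
  move: x xg; apply: lspan_ind => [|x y|c x|_ [c [x [y ->]]]].
  - by rewrite smul0r; exact: lspan0.
  - by rewrite smulDr; exact: lspanD.
  - by rewrite smulZr; exact: lspanZ.
  have Kx : (KD : set D) (b ** pedersen_val x).
    by case: (KM _ b (pedersen_valP x)).
  apply: lspan_sub; exists c, (pedersen_in Kx), y.
  rewrite -[pedersen_val (_ ** y)]/(pedersen_val (mul_r _ x) ** pedersen_val y).
  by rewrite smulA -(@pedersen_mul_r _ b x (pedersen_in Kx)).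
move: x xg; apply: lspan_ind => [|x y|c x|_ [c [x [y ->]]]].
- by rewrite smul0l; exact: lspan0.
- by rewrite smulDl; exact: lspanD.
- by rewrite smulZl; exact: lspanZ.
have Ky : (KD : set D) (pedersen_val y ** b).
  by case: (KM _ b (pedersen_valP y)).
apply: lspan_sub; exists c, x, (pedersen_in Ky).
by rewrite -[LHS]/(pedersen_val (mul_r (psi (i c)) x) ** pedersen_val y ** b) -smulA.
Qed.

(** Three approximations within [e / 3]: [x] by [y] in K(D), [y] by [y i(c)] through [kappa_small],
    and this by [y i(c) g] with [g] from an approximate unit of [D]. *)
Lemma gen_dense : dense (lspan gen).
Proof.
have [KI Kd _] := pedersenP KD.
apply: approx_dense => x e e0; have e3 : 0 < e / 3 by rewrite divr_gt0.
have [y0 Ky xy] := dense_approx x Kd e3; pose y := pedersen_in Ky.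
have [c yc] := kappa_small (inr y) e3.
pose w := mul_r (psi (i c)) y.
have {}yc : rnorm (pedersen_val y - pedersen_val w) < e / 3.
  have [[plin _ _] _] := psi_iso; move: yc; rewrite /= (linear_sub plin).
  have p1 : mul_r (psi one) y = y by apply: j_inj; rewrite -jr one_r.
  by rewrite -[mul_r _ y]/(mul_r (psi one) y - w) p1.
have [||g Kg] := @approx_unit _ _ _ KI [:: pedersen_val w] (e / 3) _ _ e3.
- exact: pedersenS.
- by move=> z; rewrite inE => /eqP ->; exact: (pedersen_valP w).
move=> /(_ _ (mem_head _ _))[_ wg].
exists (pedersen_val w ** g).
  by apply: lspan_sub; exists c, y, (pedersen_in Kg).
have := rnorm_triangle (pedersen_val w) (pedersen_val y) (pedersen_val w ** g).
move: xy yc wg; rewrite -[y0]/(pedersen_val y).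
have := rnorm_triangle (pedersen_val y) x (pedersen_val w ** g); lra.
Qed.

Lemma pedersen_sub d : exists c, j d = i c.
Proof.
have [ilin _ _] := i_hom; have [jlin jM _] := j_hom.
have [_ _ Kmin] := pedersenP KD.
have dg := Kmin _ gen_ideal gen_dense _ (pedersen_valP d).
suff h z : lspan gen z -> exists2 y : pedersen_alg KD, pedersen_val y = z &
    exists c, j y = i c.
  by have [y /subalg_inj ->] := h _ dg.
move: z {dg}; apply: lspan_ind.
- by exists 0 => //; exists 0; rewrite (linear_zero ilin) (linear_zero jlin).
- move=> _ _ [x <- [c xc]] [y <- [b yb]]; exists (x + y) => //; exists (c + b).
  by rewrite (linear_add ilin) (linear_add jlin) xc yb.
- move=> k _ [x <- [c xc]]; exists (k *: x) => //; exists (k *: c).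
  by rewrite (linear_scale ilin) (linear_scale jlin) xc.
- move=> _ [c [x [y ->]]]; exists (mul_r (psi (i c)) x ** y) => //.
  (* In [A] the generator is [j x ** i c ** j y], and the image of [i] is an ideal of [A]. *)
  by rewrite jM -jr il ir; eexists.
Qed.

(* For x self-adjoint, kappa-domination bounds |y^(n+1)| by a constant times
   |x|^n, and |y^(n+1)| = |y|^(n+1) when n + 1 is a power of 2. *)
Lemma pedersen_norm_le x y : j y = i x ->
  rnorm (pedersen_val y) <= rnorm (pedersen_val x).
Proof.
have [ilin iM iS] := i_hom; have [jlin jM jS] := j_hom.
wlog xs : x y / star x = x.
  move=> wl yx; have h : j (star y ** y) = i (star x ** x).
    by rewrite jM jS iM iS yx.
  have := wl (star x ** x) _ _ h; rewrite starM starK => /(_ erefl).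
  rewrite -[pedersen_val (star y ** y)]/(star (pedersen_val y) ** pedersen_val y).
  rewrite -[pedersen_val (star x ** x)]/(star (pedersen_val x) ** pedersen_val x).
  by rewrite !rnorm_star_smul ler_sqr ?nnegrE ?rnorm_ge0.
move=> yx; have ys : star y = y by apply: j_inj; rewrite jS yx -iS xs.
have [s [C hC]] := phi_psi (inl y).
pose v (z : pedersen_alg KB + pedersen_alg KB) : R :=
  match z with inl u => rnorm (pedersen_val u) | inr u => rnorm (pedersen_val u) end.
(* Powers are formed in [A], where [a 0] is the unit; [psi (a n)] maps [y] to the power of exponent
   [n + 1]. *)
pose a n := iter n (smul (i x)) one.
have al n z : mul_l (phi (a n)) z = iter n (smul x) z.
  elim: n => [|n ih]; first by apply: i_inj; rewrite -il one_l.
  by apply: i_inj; rewrite -il /a iterS -smulA il -/(a n) ih iterS iM.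
have ar n z : rnorm (pedersen_val (mul_r (phi (a n)) z)) <=
    rnorm (pedersen_val x) ^+ n * rnorm (pedersen_val z).
  elim: n z => [|n ih] z.
    suff -> : mul_r (phi (a 0)) z = z by rewrite expr0 mul1r.
    by apply: i_inj; rewrite -ir one_r.
  have -> : mul_r (phi (a n.+1)) z = mul_r (phi (a n)) (z ** x).
    by apply: i_inj; rewrite -!ir iM /a iterS smulA.
  rewrite (le_trans (ih _))// exprSr -mulrA ler_wpM2l ?exprn_ge0 ?rnorm_ge0//.
  by rewrite mulrC; exact: (rnormM (pedersen_val z) (pedersen_val x)).
have kap z n : rkappa z (phi (a n)) <= rnorm (pedersen_val x) ^+ n * v z.
  case: z => z; last exact: ar.
  rewrite /= al; elim: n => [|n ih] /=; first by rewrite expr0 mul1r.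
  apply: (le_trans (rnormM (pedersen_val x) _)).
  by rewrite exprS -mulrA ler_wpM2l ?rnorm_ge0.
have bound n : rnorm (pedersen_val (iter n (smul y) y)) <=
    `|C| * (\sum_(z <- s) v z) * rnorm (pedersen_val x) ^+ n.
  have -> : iter n (smul y) y = mul_l (psi (a n)) y.
    apply: j_inj; rewrite -jl; elim: n => [|n ih]; first by rewrite one_l.
    by rewrite !iterS jM ih yx /a smulA.
  apply: (le_trans (hC _)); rewrite -mulrA.
  apply: (@le_trans _ _ (`|C| * \sum_(z <- s) rkappa z (phi (a n)))).
    apply: ler_wpM2r; last exact: ler_norm.
    by apply: sumr_ge0 => -[z|z] _; exact: rnorm_ge0.
  apply: ler_wpM2l => //; rewrite mulr_suml; apply: ler_sum => z _.
  by rewrite mulrC kap.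
apply: (@le_of_pow2_le _ _ _ (`|C| * (\sum_(z <- s) v z))); rewrite ?rnorm_ge0// => k.
have iterE n : pedersen_val (iter n (smul y) y) =
    iter n (smul (pedersen_val y)) (pedersen_val y).
  by elim: n => //= n <-.
rewrite -rnorm_iter_smul -?iterE; first exact: bound.
exact: (congr1 (@pedersen_val _ _ KD) ys).
Qed.

End Comparison.

(** The two inclusions show that [i] and [j] have the same image, so [f], the inverse of [j] after
    [i], is a bijection of the Pedersen ideals; the two norm inequalities make it isometric. *)
Lemma cstar_isomorphic_of_kappa (R : realType) (A : starAlgType R) (one : A)
    (B D : cstarType R) (KB : pedersen B) (KD : pedersen D)
    (phi : A -> multiplier (pedersen_alg KB))
    (psi : A -> multiplier (pedersen_alg KD)) :
  (forall a, one ** a = a) -> (forall a, a ** one = a) ->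
  star_iso phi -> star_iso psi ->
  kappa_dominated phi psi -> kappa_dominated psi phi ->
  cstar_isomorphic B D.
Proof.
move=> one_l one_r phi_iso psi_iso dom dom'.
have [i [i_hom i_inj iE il ir]] := pedersen_embedding phi_iso.
have [j [j_hom j_inj jE jl jr]] := pedersen_embedding psi_iso.
have /choice[f fE] : forall x, exists y, j y = i x.
  move=> x.
  have [y ->] := pedersen_sub one_l one_r psi_iso phi_iso dom' j_hom j_inj jE jl jr
    i_hom i_inj ir x.
  by exists y.
have [ilin iM iS] := i_hom; have [jlin jM jS] := j_hom.
apply: (@cstar_isomorphic_of_pedersen _ _ _ KB KD f).
  split.
    split.
    - by move=> k x y; apply: j_inj; rewrite jlin !fE ilin.
    - by move=> x y; apply: j_inj; rewrite jM !fE iM.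
    - by move=> x; apply: j_inj; rewrite jS !fE iS.
  apply: inj_surj_bij => [x y xy|y].
    by apply: i_inj; rewrite -!fE xy.
  have [x xy] := pedersen_sub one_l one_r phi_iso psi_iso dom i_hom i_inj iE il ir
    j_hom j_inj jr y.
  by exists x; apply: j_inj; rewrite fE.
move=> x; apply/eqP; rewrite eq_le; apply/andP; split.
  exact: (pedersen_norm_le one_l one_r dom i_hom i_inj il ir j_hom j_inj jl (fE x)).
exact: (pedersen_norm_le one_l one_r dom' j_hom j_inj jl jr i_hom i_inj il
  (esym (fE x))).
Qed.

Theorem theorem3p1 (R : realType) (A : starAlgType R) (L : lc_sigma_cstar A) :
  exists K : pedersen (A0 L),
  [/\ [set A0_val x | x in (K : set (A0 L))] = A00 (lc_seq L),
      exists phi : A -> multiplier (pedersen_alg K),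
        star_iso phi /\
        @homeomorphism (proj_topology L) (Gamma_proj_topology K) phi,
      exists psi : Ab L -> multiplier (A0 L),
        star_iso psi /\ (forall x, multiplier_norm (psi x) = (rnorm x)%:E) &
      forall (C0 D0 : cstarType R) (KC : pedersen C0) (KD : pedersen D0),
        (exists phi : A -> multiplier (pedersen_alg KC), star_iso phi /\
           @homeomorphism (A00_topology (lc_seq L)) (Gamma_kappa_topology KC)
             phi) ->
        (exists phi : A -> multiplier (pedersen_alg KD), star_iso phi /\
           @homeomorphism (A00_topology (lc_seq L)) (Gamma_kappa_topology KD)
             phi) ->
        cstar_isomorphic C0 D0].
Proof.
exists (A00_pedersen L); split.
- apply/seteqP; split=> [_ [x Jx <-] //|x Jx].
  by exists (A00_to_A0 Jx).
- by exists (@K_mult _ _ L); split; [exact: K_mult_iso|exact: K_mult_homeo].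
- by exists (@Ab_mult _ _ L); split; [exact: Ab_mult_iso|exact: Ab_mult_norm].
- move=> C0 D0 KC KD [phi [phi_iso phi_homeo]] [psi [psi_iso psi_homeo]].
  apply: (cstar_isomorphic_of_kappa (@lc_one_l _ _ L) (@lc_one_r _ _ L)
    phi_iso psi_iso).
    apply: (@homeo_kappa_dominated _ (A00_topology (lc_seq L))) => //.
      by case: psi_homeo.
    have [[plin _ _] pb] := phi_iso; have [[qlin _ _] _] := psi_iso.
    move=> c _ t t' <-; rewrite -(linear_scale plin) => /(bij_inj pb) ->.
    exact: linear_scale.
  apply: (@homeo_kappa_dominated _ (A00_topology (lc_seq L))) => //.
    by case: phi_homeo.
  have [[plin _ _] _] := phi_iso; have [[qlin _ _] qb] := psi_iso.
  move=> c _ t t' <-; rewrite -(linear_scale qlin) => /(bij_inj qb) ->.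
  exact: linear_scale.
Qed.
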